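(* For every integer $d\ge2$ there exist positive constants $\beta_1,\beta_2$ depending only on $d$, and for every $\sigma>0$ a constant $c(d,\sigma)>0$ depending only on $d$ and $\sigma$, such that the following holds. For any positive $\delta$ and $v$ with $\beta_1\delta^{d-1}<v<\beta_2$, one can find a convex body $D\subset\mathbb{R}^d$ and a point $\boldsymbol{x}\in D$ (depending on $d,\delta,v$ but not on $n$ or $\sigma$) satisfying $B^d\subset D\subset 3B^d$, $\delta=\mathrm{dist}(\boldsymbol{x},\partial D)$, and $$v=\mathrm{Vol}_{d-1}(\{\boldsymbol{y}\in D:(\boldsymbol{y}-\boldsymbol{x})\perp\boldsymbol{u}\}),$$ where $\boldsymbol{u}$ is a unit vector such that $\boldsymbol{x}+\delta\boldsymbol{u}\in\partial D$ (so that $\max\{t:\boldsymbol{x}+t\boldsymbol{u}\in D\}\le\mathrm{dist}(\boldsymbol{x},\partial D)$ and the hyperplane through $\boldsymbol{x}+\delta\boldsymbol{u}$ with normal vector $\boldsymbol{u}$ is supporting to $D$), and such that for any $\sigma>0$ and any positive integer $n$ with $\delta>\sigma n^{-2}$, $$\lambda_n(D,\boldsymbol{x})\ge c(d,\sigma)\,n^{-d}\min\{\sqrt{\delta},\ \delta^{1-d/2}v\}.$$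
   Context: A convex body is a convex compact set with non-empty interior; $\partial D$ is the boundary of $D$; $|\cdot|$ is the Euclidean norm, $B^d=\{\boldsymbol{y}\in\mathbb{R}^d:|\boldsymbol{y}|\le1\}$, $\mathrm{dist}(\boldsymbol{x},Y)=\inf\{|\boldsymbol{x}-\boldsymbol{y}|:\boldsymbol{y}\in Y\}$; $\mathrm{Vol}_k$ is the $k$-dimensional volume. Let $\mathcal{P}_{n,d}$ be the space of all real algebraic polynomials of total degree $\le n$ in $d$ variables. For a compact set $D\subset\mathbb{R}^d$ with non-empty interior, the Christoffel function (with uniform weight) is $\lambda_n(D,\boldsymbol{x})=\left(\sum_{k=1}^N\varphi_k(\boldsymbol{x})^2\right)^{-1}$, $\boldsymbol{x}\in D$, where $\{\varphi_k\}_{k=1}^N$ is an orthonormal basis of $\mathcal{P}_{n,d}$ with respect to $\langle f,g\rangle=\int_D f(\boldsymbol{y})g(\boldsymbol{y})\,d\boldsymbol{y}$. Equivalently, $\lambda_n(D,\boldsymbol{x})=\min\{\int_D f^2(\boldsymbol{y})\,d\boldsymbol{y}: f\in\mathcal{P}_{n,d},\ |f(\boldsymbol{x})|=1\}$. *)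

(* Defs.v *)
From HB Require Import structures.
From mathcomp Require Import all_boot all_order all_algebra.
(* multinomials' notations clash with those of mathcomp-analysis, so the type
   {mpoly R[d]} is written mpoly d R and p.@[v] is written meval v p. *)
From mathcomp Require Import -(notations) mpoly.
From mathcomp Require Import all_classical all_reals all_analysis.

Set Implicit Arguments.
Unset Strict Implicit.
Unset Printing Implicit Defensive.

Import Order.TTheory GRing.Theory Num.Theory numFieldNormedType.Exports.

Local Open Scope classical_set_scope.
Local Open Scope ring_scope.

Section LebesgueMeasure.
Context {R : realType}.

Definition coord n (i : 'I_n) (x : 'rV[R]_n) : measurableTypeR R := x 0 i.

(* 'rV[R]_n carries the product sigma-algebra, the coarsest one making all the
   coordinates measurable, i.e. the Borel sigma-algebra of R^n. *)
Definition rV_measurable n : set (set 'rV[R]_n) := g_sigma_preimage (@coord n).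

Let rV_measurable0 n : @rV_measurable n set0.
Proof. exact: sigma_algebra0. Qed.

Let rV_measurableC n A : @rV_measurable n A -> @rV_measurable n (~` A).
Proof. exact: sigma_algebraC. Qed.

Let rV_measurable_bigcup n (F : (set 'rV[R]_n)^nat) :
  (forall i, rV_measurable (F i)) -> rV_measurable (\bigcup_i (F i)).
Proof. exact: sigma_algebra_bigcup. Qed.

HB.instance Definition _ n := @isMeasurable.Build default_measure_display
  'rV[R]_n (@rV_measurable n) (@rV_measurable0 n) (@rV_measurableC n)
  (@rV_measurable_bigcup n).

Lemma measurable_coord n (i : 'I_n) : measurable_fun setT (@coord n i).
Proof.
move=> _ Y mY; rewrite setTI; apply: sub_sigma_algebra => /=.
rewrite -bigcup_seq/=; exists i => /=; first by rewrite mem_index_enum.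
by exists Y => //; rewrite setTI.
Qed.

Lemma measurable_fun_coordP d (T : measurableType d) n (f : T -> 'rV[R]_n) :
  (forall i, measurable_fun setT (fun t => coord i (f t))) ->
  measurable_fun setT f.
Proof.
move=> mf _ A mA.
suff : g_sigma_preimage (fun i => @coord n i \o f) `<=` measurable.
  by apply; rewrite g_sigma_preimage_comp; exists A.
apply: smallest_sub; first exact: sigma_algebra_measurable.
case: n => [|n] in f mf A mA *; first by rewrite big_ord0.
rewrite -bigcup_mkord_ord; apply: bigcup_sub => i Ii.
by move=> B [C mC <-]; exact: mf.
Qed.

Definition rV_cons n (z : measurableTypeR R * 'rV[R]_n) : 'rV[R]_n.+1 :=
  \row_(i < n.+1) oapp (fun j => z.2 0 j) z.1 (unlift ord0 i).

Definition rV_uncons n (x : 'rV[R]_n.+1) : measurableTypeR R * 'rV[R]_n :=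
  (x 0 ord0, \row_(j < n) x 0 (lift ord0 j)).

Lemma rV_consK n : cancel (@rV_cons n) (@rV_uncons n).
Proof.
move=> [a y]; rewrite /rV_uncons /rV_cons !mxE unlift_none; congr pair.
by apply/rowP => j; rewrite !mxE liftK.
Qed.

Lemma measurable_rV_cons n : measurable_fun setT (@rV_cons n).
Proof.
apply: measurable_fun_coordP => i; rewrite /coord /rV_cons.
case: (unliftP ord0 i) => [j ->|->].
  rewrite (_ : (fun t => _) = coord j \o snd); last first.
    by apply/funext => z; rewrite mxE liftK.
  by apply: measurableT_comp; [exact: measurable_coord|].
rewrite (_ : (fun t => _) = fst) //.
by apply/funext => z; rewrite mxE unlift_none.
Qed.

Lemma measurable_rV_uncons n : measurable_fun setT (@rV_uncons n).
Proof.
apply/measurable_fun_pairP; split; first exact: measurable_coord.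
apply: measurable_fun_coordP => j.
rewrite (_ : (fun t => _) = coord (lift ord0 j)); first exact: measurable_coord.
by apply/funext => x; rewrite /coord /= mxE.
Qed.

Section Step.
Variables (n : nat) (mu : {sigma_finite_measure set 'rV[R]_n -> \bar R}).

Definition lebesgue_step : set 'rV[R]_n.+1 -> \bar R :=
  pushforward (@lebesgue_measure R \x mu)%E (@rV_cons n).

Let mcons := @measurable_rV_cons n.

Let lebesgue_step0 : lebesgue_step set0 = 0%E.
Proof. exact: measure0. Qed.

Let lebesgue_step_ge0 A : (0 <= lebesgue_step A)%E.
Proof. exact: measure_ge0. Qed.

Let lebesgue_step_sigma_additive : semi_sigma_additive lebesgue_step.
Proof. exact: measure_semi_sigma_additive. Qed.

HB.instance Definition _ := isMeasure.Build _ _ _ lebesgue_step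
  lebesgue_step0 lebesgue_step_ge0 lebesgue_step_sigma_additive.

Let lebesgue_step_sigma_finite : sigma_finite setT lebesgue_step.
Proof.
have /sigma_finiteP[F [TF ndF Foo]] :=
  sigma_finiteT (@lebesgue_measure R : {sigma_finite_measure set _ -> \bar R}).
have /sigma_finiteP[G [TG ndG Goo]] := sigma_finiteT mu.
exists (fun k => @rV_uncons n @^-1` (F k `*` G k)).
  rewrite -preimage_bigcup; apply/esym/seteqP; split=> // x _.
  have [k _ Fk] : (\bigcup_i F i) (rV_uncons x).1 by rewrite -TF.
  have [l _ Gl] : (\bigcup_i G i) (rV_uncons x).2 by rewrite -TG.
  exists (maxn k l) => //; split.
  - by move: Fk; exact/subsetPset/ndF/leq_maxl.
  - by move: Gl; exact/subsetPset/ndG/leq_maxr.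
move=> k; have [mF Fk] := Foo k; have [mG Gk] := Goo k; split.
  rewrite -[X in measurable X]setTI; apply: measurable_rV_uncons => //.
  exact: measurableX.
rewrite /lebesgue_step /pushforward -comp_preimage.
rewrite (_ : _ \o _ = id); last exact/funext/rV_consK.
by rewrite preimage_id product_measure1E// lte_mul_pinfty// ge0_fin_numE.
Qed.

HB.instance Definition _ := Measure_isSigmaFinite.Build _ _ _ lebesgue_step
  lebesgue_step_sigma_finite.

End Step.

Fixpoint lebesgue_rV n : {sigma_finite_measure set 'rV[R]_n -> \bar R} :=
  if n is m.+1 then lebesgue_step (lebesgue_rV m) else \d_(0 : 'rV[R]_0).

End LebesgueMeasure.

Section Geometry.
Context {R : realType} {d : nat}.
Implicit Types (x y u : 'rV[R]_d) (D A : set 'rV[R]_d).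

Definition dotv x y : R := \sum_(i < d) x 0 i * y 0 i.

(* The library norm `|x| on 'rV[R]_d is the sup norm; it defines the same
   topology as the Euclidean norm. *)
Definition enorm x : R := Num.sqrt (dotv x x).

Definition unit_ball : set 'rV[R]_d := [set y | enorm y <= 1].

Definition boundary D : set 'rV[R]_d := closure D `\` D°.

Definition dist x A : R := inf [set enorm (x - y) | y in A].

Definition convex_body D : Prop :=
  [/\ convex_set (D : set (convex_lmodType 'rV[R]_d)), compact D & D° !=set0].

Definition supporting_hyperplane D x u : Prop :=
  D x /\ forall y, D y -> dotv (y - x) u <= 0.

(* The rows of Q form an orthonormal basis of the orthogonal complement of u. *)
Definition orthonormal_frame u (Q : 'M[R]_(d.-1, d)) : Prop :=
  Q *m Q^T = 1%:M /\ forall i, dotv (row i Q) u = 0.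

(* (d-1)-dimensional volume of a subset A of the hyperplane through x with
   normal u, which is identified with R^(d-1) by the isometry z |-> x + zQ.
   Every orthonormal frame Q gives the same value. *)
Definition hyperplane_volume x u A : \bar R :=
  let Q := get [set Q | orthonormal_frame u Q] in
  lebesgue_rV d.-1 [set z | A (x + z *m Q)].

End Geometry.

Section Christoffel.
Context {R : realType} {d : nat}.
Implicit Types (p q : mpoly d R) (D : set 'rV[R]_d).

Definition polys_of_degree_le (n : nat) : set (mpoly d R) :=
  [set p | (msize p <= n.+1)%N].

Definition peval p (x : 'rV[R]_d) : R := meval (fun i => x 0 i) p.

Definition inner_product D p q : R :=
  \int[@lebesgue_rV R d]_(y in D) (peval p y * peval q y).

Definition orthonormal_basis D n N (phi : 'I_N -> mpoly d R) : Prop :=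
  [/\ forall k, polys_of_degree_le n (phi k),
      forall i j, inner_product D (phi i) (phi j) = (i == j)%:R
    & forall p, polys_of_degree_le n p ->
        exists c : 'I_N -> R, p = \sum_(k < N) c k *: phi k].

(* All orthonormal bases give the same value, and one exists when D is compact
   with non-empty interior. *)
Definition christoffel D n (x : 'rV[R]_d) : R :=
  xget 0 [set l | exists N (phi : 'I_N -> mpoly d R),
    orthonormal_basis D n phi /\ l = (\sum_(k < N) peval (phi k) x ^+ 2)^-1].

End Christoffel.

(* Main.v *)
Require Import Defs.
From mathcomp Require Import all_boot all_order all_algebra.
From mathcomp Require Import -(notations) mpoly.
From mathcomp Require Import all_classical all_reals all_analysis.
From mathcomp Require Import measurable_realfun.
From mathcomp Require Import ring lra zify.

(* D is a truncated cone about the first axis, whose section at depth delta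
   below its top face is a ball of radius r, where v = r^(d-1) |B^(d-1)|.
   By AM-GM, D contains the region swept by the vertical segments of length 1
   hanging from the paraboloid s = |z|^2 / a^2, with s the depth and
   a = min(1, r / sqrt delta).  The shear (s, z) |-> (s + |z|^2 / a^2, z)
   preserves volume and turns a polynomial of degree n into one of degree at
   most n in s and at most 2n in each coordinate of z, so the Christoffel
   function at the point x at depth delta is bounded below by a product of
   one-dimensional ones: sqrt delta / n in the direction of s and a / n in each
   direction of z.  The product is of order n^(-d) sqrt delta a^(d-1).

   In dimension one the claim is p(delta)^2 <= C n / sqrt delta int_0^1 p^2.
   Put s = (1 - cos x) / 2 and multiply p(s)^2 by the cosine polynomial
   (1 + cos x) (1 - cos m x) / 4 with m of order 1 / sqrt delta.  Sums of the
   product over sufficiently many equally spaced nodes do not depend on the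
   first node, hence bound its value at any point, and the product is at most
   m / 2 times p(s)^2 |sin x|, the integrand after the substitution. *)

Set Implicit Arguments.
Unset Strict Implicit.
Unset Printing Implicit Defensive.
Import Order.TTheory GRing.Theory Num.Theory numFieldNormedType.Exports.
Local Open Scope classical_set_scope.
Local Open Scope ring_scope.

(** * Univariate polynomials *)

Section TrigonometricSums.
Context {R : realType}.
Implicit Types (a b x y : R).

Lemma sin_natmul_le k x : `|sin (k%:R * x)| <= k%:R * `|sin x|.
Proof.
elim: k => [|k IH]; first by rewrite !mul0r sin0 normr0.
rewrite -natr1 !mulrDl !mul1r sinD (le_trans (ler_normD _ _))// lerD//.
- by rewrite normrM (le_trans _ IH)// ler_piMr// cos_max.
- by rewrite normrM ler_piMl// cos_max.
Qed.

Lemma sin_le_id x : 0 <= x -> sin x <= x.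
Proof.
move=> x0.
have [c _] := @MVT_segment R (@sin R) (@cos R) 0 x x0
  (fun y _ => is_derive_sin y) (continuous_subspaceT (@continuous_sin R)).
rewrite sin0 !subr0 => ->.
by rewrite ler_piMl// cos_le1.
Qed.

(** After multiplication by [sin b], where [b = l pi / M] is half the phase step, each summand is a
    difference of consecutive sines. The sum telescopes, and its two ends differ by [l] full
    periods. The bounds on [l] give [0 < b < pi], so [sin b] can be cancelled. *)
Lemma sum_cos_eq0 (M l : nat) a : (0 < l < M)%N ->
  \sum_(k < M) cos (l%:R * (a + k%:R * (2 * pi / M%:R))) = 0 :> R.
Proof.
move=> /andP[l0 lM].
have M0 : (0 < M%:R :> R) by rewrite ltr0n (leq_trans _ lM).
pose b : R := l%:R * pi / M%:R.
have sb : sin b != 0.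
  rewrite gt_eqF// sin_gt0_pi// /b; apply/andP; split.
    by rewrite divr_gt0// mulr_gt0 ?ltr0n// pi_gt0.
  by rewrite ltr_pdivrMr// mulrC ltr_pM2l ?pi_gt0// ltr_nat.
apply: (mulfI sb); rewrite mulr0 mulr_sumr.
pose g (k : nat) := sin (l%:R * a + k%:R * (2 * b) - b) / 2.
transitivity (\sum_(0 <= k < M) (g k.+1 - g k)).
  rewrite big_mkord; apply: eq_bigr => k _.
  have -> : l%:R * (a + k%:R * (2 * pi / M%:R)) = l%:R * a + k%:R * (2 * b).
    by rewrite /b; field; rewrite gt_eqF.
  set w := l%:R * a + _.
  have -> : g k = sin (w - b) / 2 by [].
  have -> : g k.+1 = sin (w + b) / 2.
    by rewrite /g -natr1; congr (sin _ / 2); rewrite /w; ring.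
  by rewrite sinD sinB; field.
rewrite telescope_sumr// /g mul0r addr0.
have -> : l%:R * a + M%:R * (2 * b) - b = (l%:R * a - b) + (pi *+ 2) *+ l.
  by rewrite /b -mulr_natl -(mulr_natl (pi *+ 2)); field; rewrite gt_eqF.
rewrite periodicn; first by rewrite subrr.
exact: sinD2pi.
Qed.

(** Induction on [j]: the product formula trades one factor [cos x] against the frequencies [l + 1]
    and [l - 1], which keeps the total degree below [M]. For [l = 0] one factor of the power serves
    as the cosine of frequency 1. *)
Lemma sum_cosXcos_shift (M j l : nat) a b : (j + l < M)%N ->
  \sum_(k < M) cos (a + k%:R * (2 * pi / M%:R)) ^+ j *
               cos (l%:R * (a + k%:R * (2 * pi / M%:R))) =
  \sum_(k < M) cos (b + k%:R * (2 * pi / M%:R)) ^+ j *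
               cos (l%:R * (b + k%:R * (2 * pi / M%:R))).
Proof.
elim: j l => [|j IH] [|l] jl.
- by apply: eq_bigr => k _; rewrite !mul0r.
- under eq_bigr do rewrite expr0 mul1r.
  under [RHS]eq_bigr do rewrite expr0 mul1r.
  by rewrite !sum_cos_eq0.
- under eq_bigr do rewrite mul0r cos0 mulr1 exprSr -[X in _ * cos X]mul1r.
  under [RHS]eq_bigr do rewrite mul0r cos0 mulr1 exprSr -[X in _ * cos X]mul1r.
  by apply: (IH 1%N); lia.
have step x : cos x ^+ j.+1 * cos (l.+1%:R * x) =
    (cos x ^+ j * cos (l.+2%:R * x) + cos x ^+ j * cos (l%:R * x)) / 2.
  have -> : l.+2%:R * x = l.+1%:R * x + x by rewrite -[l.+2%:R]natr1; ring.
  have -> : l%:R * x = l.+1%:R * x - x by rewrite -[l.+1%:R]natr1; ring.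
  by rewrite cosD cosB exprS; field.
under eq_bigr do rewrite step.
under [RHS]eq_bigr do rewrite step.
rewrite -!mulr_suml !big_split/= (IH l.+2) ?(IH l)//; lia.
Qed.

Lemma sum_horner_cos_shift (M m : nat) (P : {poly R}) a b :
  (size P + m <= M)%N ->
  \sum_(k < M) P.[cos (a + k%:R * (2 * pi / M%:R))] *
               (1 - cos (m%:R * (a + k%:R * (2 * pi / M%:R)))) =
  \sum_(k < M) P.[cos (b + k%:R * (2 * pi / M%:R))] *
               (1 - cos (m%:R * (b + k%:R * (2 * pi / M%:R)))).
Proof.
move=> PM.
have expand c : \sum_(k < M) P.[cos (c + k%:R * (2 * pi / M%:R))] *
      (1 - cos (m%:R * (c + k%:R * (2 * pi / M%:R)))) =
   \sum_(j < size P) P`_j *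
     (\sum_(k < M) cos (c + k%:R * (2 * pi / M%:R)) ^+ j *
               cos (0%:R * (c + k%:R * (2 * pi / M%:R)))
     - \sum_(k < M) cos (c + k%:R * (2 * pi / M%:R)) ^+ j *
               cos (m%:R * (c + k%:R * (2 * pi / M%:R)))).
  under eq_bigr do rewrite horner_coef mulr_suml.
  rewrite exchange_big/=; apply: eq_bigr => j _.
  rewrite mulrBr !mulr_sumr -sumrB; apply: eq_bigr => k _.
  by rewrite mul0r cos0; ring.
rewrite !expand; apply: eq_bigr => j _; congr (_ * (_ - _)).
- by apply: sum_cosXcos_shift; rewrite addn0 (leq_trans (ltn_ord j))// (leq_trans _ PM)// leq_addr.
- by apply: sum_cosXcos_shift; rewrite (leq_trans _ PM)// ltn_add2r.
Qed.

End TrigonometricSums.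

(** * Point values of a squared polynomial against its primitive *)

Section UnivariateChristoffel.
Context {R : realType}.
Implicit Types (p F : {poly R}) (a b c x : R).

Lemma size_polyM_le (p q : {poly R}) (a b : nat) :
  (size p <= a.+1)%N -> (size q <= b.+1)%N -> (size (p * q)%R <= (a + b).+1)%N.
Proof. by move=> pa qb; have := size_polyMleq p q; lia. Qed.

Lemma is_derive_horner_cos F e c a :
  is_derive a 1 (fun x => e * F.[(1 - cos (x + c)) / 2])
                (e * (F^`().[(1 - cos (a + c)) / 2] * (sin (a + c) / 2))).
Proof.
have dh : is_derive a 1 (fun x => (1 - cos (x + c)) / 2) (sin (a + c) / 2).
  apply: (@trigger_derive R _ a (2^-1 * (0 - (- sin (a + c) * (1 + 0))))); last by field.
  have -> : (fun x => (1 - cos (x + c)) / 2) =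
      2^-1 \*: (cst 1 - (cos \o (@id R + cst c))).
    by apply/funext => x /=; rewrite !fctE /= mulrC.
  apply: is_deriveZ.
have -> : (fun x => e * F.[(1 - cos (x + c)) / 2]) =
    e \*: (horner F \o (fun x => (1 - cos (x + c)) / 2)).
  by apply/funext => x.
exact: is_deriveZ.
Qed.

(** With [y = x / 2] the left side is [cos(y)^2 sin(m y)^2]. Both bases are at most 1 in absolute
    value, so each square is at most any bound of its base: [|cos y|] and [m |sin y|]. *)
Lemma weight_le m x :
  (1 + cos x) / 2 * ((1 - cos (m%:R * x)) / 2) <= m%:R / 2 * `|sin x|.
Proof.
set y := x / 2; have -> : x = y *+ 2 by rewrite -mulr_natr /y; field.
have -> : m%:R * (y *+ 2) = (m%:R * y) *+ 2 by rewrite mulrnAr.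
rewrite !cos_mulr2n sin_mulr2n.
set z := m%:R * y.
have -> : (1 + (cos y ^+ 2 *+ 2 - 1)) / 2 = cos y ^+ 2 by field.
have -> : (1 - (cos z ^+ 2 *+ 2 - 1)) / 2 = sin z ^+ 2.
  by rewrite sin2cos2; field.
have -> : m%:R / 2 * `|(cos y * sin y) *+ 2| = `|cos y| * (m%:R * `|sin y|).
  by rewrite normrMn normrM; field.
have sq_le (u w : R) : `|u| <= 1 -> `|u| <= w -> u ^+ 2 <= w.
  move=> u1 uw; rewrite -real_normK ?num_real// expr2.
  by rewrite (le_trans _ uw)// ler_piMl.
apply: ler_pM; rewrite ?sqr_ge0//; apply: sq_le => //.
- exact: cos_max.
- exact: sin_max.
- exact: sin_natmul_le.
Qed.

(* The weight factors are chosen so that their product is dominated by the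
   density |sin| of the substitution s = (1 - cos x) / 2, while the whole left
   side stays a cosine polynomial in x, whose sums over equally spaced nodes do
   not depend on the first node. *)
Lemma horner_cos_sqr_le p F (n m : nat) x :
  (size p <= n.+1)%N -> F^`() = p ^+ 2 -> (0 < m)%N ->
  p.[(1 - cos x) / 2] ^+ 2 * ((1 + cos x) / 2 * ((1 - cos (m%:R * x)) / 2)) <=
  2 * m%:R * (n + m).+1%:R / pi * (F.[1] - F.[0]).
Proof.
(* The cosine polynomial below has degree at most [2n + 1 + m], less than [M]. Taking [M] even puts
   [L] nodes on each half circle. *)
move=> sp dF m0; set L := (n + m).+1; pose M := (L + L)%N.
have M0 : 0 < M%:R :> R by rewrite ltr0n.
pose h : R := 2 * pi / M%:R.
have h0 : 0 < h by rewrite divr_gt0// mulr_gt0// pi_gt0.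
pose f y := p.[(1 - cos y) / 2] ^+ 2 *
  ((1 + cos y) / 2 * ((1 - cos (m%:R * y)) / 2)).
pose P : {poly R} := (p \Po (2^-1 *: (1 - 'X))) ^+ 2 * (4^-1 *: (1 + 'X)).
have fP y : f y = P.[cos y] * (1 - cos (m%:R * y)).
  have -> : P.[cos y] = p.[(1 - cos y) / 2] ^+ 2 * (4^-1 * (1 + cos y)).
    by rewrite /P hornerM horner_exp horner_comp !hornerE (mulrC 2^-1).
  by rewrite /f; field.
have sP : (size P + m <= M)%N.
  have size2 (q : {poly R}) : (size q <= 2)%N -> (size (p \Po q) <= n.+1)%N.
    move=> sq; rewrite (leq_trans (size_comp_poly_leq _ _))// ltnS.
    have : ((size p).-1 * (size q).-1 <= (size p).-1 * 1)%N by rewrite leq_mul2l; lia.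
    lia.
  have s1X (c : R) (q : {poly R}) : (size q <= 2)%N -> (size (c *: (1 + q)) <= 2)%N.
    move=> sq; rewrite (leq_trans (size_scale_leq _ _))//.
    by rewrite (leq_trans (size_polyD _ _))// geq_max sq size_poly1.
  have sA : (size (p \Po (2^-1 *: (1 - 'X)))%R <= n.+1)%N.
    by apply: size2; apply: s1X; rewrite size_polyN size_polyX.
  have sB : (size (4^-1 *: (1 + 'X) : {poly R})%R <= 2)%N.
    by apply: s1X; rewrite size_polyX.
  rewrite (_ : M = ((n + n) + 1).+1 + m + m)%N; last by rewrite /M /L; lia.
  rewrite (leq_trans _ (leq_addr _ _))// leq_add2r /P.
  by apply: size_polyM_le => //; rewrite expr2; exact: size_polyM_le.
pose N a := \sum_(k < M) f (a + k%:R * h).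
have Nconst a b : N a = N b.
  rewrite /N; under eq_bigr do rewrite fP.
  under [RHS]eq_bigr do rewrite fP.
  exact: sum_horner_cos_shift.
have f0 (y : R) : 0 <= f y.
  apply: mulr_ge0; first exact: sqr_ge0.
  apply: mulr_ge0; apply: divr_ge0 => //.
have fN : f x <= N x.
  have M0' : (0 < M)%N by rewrite /M /L addSn.
  rewrite /N (bigD1 (Ordinal M0'))//= mul0r addr0 lerDl sumr_ge0//.
(* The sign of the sine on the two half circles; it turns the derivative of [F] along the nodes into
   [p^2 |sin| / 2]. *)
pose e k : R := if (k < L)%N then 1 else -1.
pose g (k : nat) (a : R) := e k * F.[(1 - cos (a + k%:R * h)) / 2].
pose dg (k : nat) (a : R) := e k * (F^`().[(1 - cos (a + k%:R * h)) / 2] *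
   (sin (a + k%:R * h) / 2)).
have gE (a : R) : (\sum_(k < M) (g k : R -> R)) a = \sum_(k < M) g k a.
  by rewrite fct_sumE.
have dG (a : R) : is_derive a 1 (\sum_(k < M) (g k : R -> R)) (\sum_(k < M) dg k a).
  by apply: is_derive_sum => k; exact: is_derive_horner_cos.
have cG : {within `[0, h], continuous (\sum_(k < M) (g k : R -> R))}.
  apply: continuous_subspaceT => a.
  by apply/differentiable_continuous/derivable1_diffP; case: (dG a).
(* The mean value theorem stands in for integration over the first node: for some first node [c] in
   [[0, h]], [h] times the sum of the derivatives is the total increment. *)
have [c c0h] := MVT h0 (fun a _ => dG a) cG.
rewrite !gE subr0 => MV.
have L0 : 0 < L%:R :> R by rewrite ltr0n.
have hL : h * L%:R = pi.
  rewrite /h /M natrD; field; rewrite gt_eqF// addr_gt0//.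
have dg_abs (k : 'I_M) : dg k c =
    p.[(1 - cos (c + k%:R * h)) / 2] ^+ 2 * (`|sin (c + k%:R * h)| / 2).
  rewrite /dg dF horner_exp mulrCA; congr (_ * _).
  move: c0h; rewrite in_itv/= => /andP[c0 ch].
  have pos (j : nat) : (j < L)%N -> 0 <= sin (c + j%:R * h).
    move=> jL; apply: sin_ge0_pi; apply/andP; split.
      by apply: addr_ge0; [exact: ltW|apply: mulr_ge0; [exact: ler0n|exact: ltW]].
    rewrite -hL (@le_trans _ _ (h + j%:R * h))// ?lerD2r ?(ltW ch)//.
    by rewrite -[X in X + _]mul1r -mulrDl mulrC ler_pM2l// nat1r ler_nat.
  rewrite /e; case: ifPn => kL; first by rewrite mul1r ger0_norm// pos.
  rewrite -leqNgt in kL.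
  have kE : k%:R = L%:R + (k - L)%:R :> R by rewrite -natrD subnKC.
  have -> : c + k%:R * h = (c + (k - L)%:R * h) + pi by rewrite kE -hL; ring.
  rewrite sinDpi mulN1r normrN ger0_norm ?mulNr// ?opprK//; apply: pos.
  by have := ltn_ord k; rewrite /M; lia.
have Nle : N c <= m%:R * \sum_(k < M) dg k c.
  rewrite mulr_sumr; apply: ler_sum => k _; rewrite dg_abs /f.
  rewrite [leRHS]mulrCA ler_wpM2l ?sqr_ge0//.
  by rewrite (le_trans (weight_le _ _))// -mulrA [2^-1 * _]mulrC.
(* A shift by [h] carries each node to the next one, so the increments chain from [F(0)] up to
   [F(1)] on the first half circle and back on the second; the signs make both contributions
   equal. *)
have tel : \sum_(k < M) g k h - \sum_(k < M) g k 0 = 2 * (F.[1] - F.[0]).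
  pose G (k : nat) := F.[(1 - cos (k%:R * h)) / 2].
  have GE (k : nat) : g k h - g k 0 = e k * (G k.+1 - G k).
    rewrite /g /G add0r -mulrBr -nat1r; congr (_ * (F.[(1 - cos _) / _] - _)).
    by ring.
  have G0 : G 0%N = F.[0] by rewrite /G mul0r cos0 subrr mul0r.
  have GL : G L = F.[1].
    by rewrite /G (mulrC _ h) hL cospi opprK -(natrD _ 1 1) divff.
  have GM : G M = F.[0].
    have -> : G M = F.[(1 - cos (pi *+ 2)) / 2].
      by congr (F.[(1 - cos _) / 2]); rewrite /M natrD mulrC mulrDr hL.
    by rewrite cos2pi subrr mul0r.
  rewrite -sumrB.
  transitivity (\sum_(0 <= k < M) e k * (G k.+1 - G k)).
    by rewrite big_mkord; apply: eq_bigr => k _; rewrite GE.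
  rewrite (@big_cat_nat _ _ _ L)//= ?leq_addr//.
  have -> : \sum_(0 <= k < L) e k * (G k.+1 - G k) = G L - G 0%N.
    rewrite -telescope_sumr//; apply: eq_big_nat => k /andP[_ kL].
    by rewrite /e kL mul1r.
  have -> : \sum_(L <= k < M) e k * (G k.+1 - G k) = - (G M - G L).
    rewrite -telescope_sumr ?leq_addr// -sumrN; apply: eq_big_nat => k /andP[Lk _].
    by rewrite /e ltnNge Lk mulN1r.
  by rewrite G0 GL GM; ring.
apply: (le_trans fN); rewrite (Nconst x c) (le_trans Nle)//.
rewrite -(ler_pM2r h0) -[leLHS]mulrA -MV tel.
have hE : h = pi / L%:R.
  by apply: (mulIf (lt0r_neq0 L0)); rewrite hL divfK ?lt0r_neq0.
rewrite hE; suff -> : forall u w X : R, u != 0 -> w != 0 ->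
    2 * m%:R * w / u * X * (u / w) = m%:R * (2 * X).
- by [].
- by rewrite lt0r_neq0// pi_gt0.
- by rewrite lt0r_neq0.
by move=> u w X u0 w0; field; rewrite u0 w0.
Qed.

End UnivariateChristoffel.

(** * One-dimensional Christoffel bounds *)

Section UnivariateChristoffelIntegral.
Context {R : realType}.
Implicit Types (p F : {poly R}) (a b c x : R).

(** Apply [horner_cos_sqr_le] at [x] with [cos x = 1 - 2 delta] and [m] the integer part of
    [pi / x]. The weight there is at least 1/4, [m] is at most of order [1 / sqrt delta], and the
    lower bound on [delta] makes [n + m + 1] at most of order [n]. *)
Lemma poly_sqr_le p F (n : nat) (sigma delta : R) :
  (size p <= n.+1)%N -> F^`() = p ^+ 2 -> (0 < n)%N -> 0 < sigma ->
  0 < delta -> delta <= 1 / 2 -> sigma * n%:R ^- 2 < delta ->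
  p.[delta] ^+ 2 <=
  8 * (1 + (Num.sqrt sigma)^-1) * n%:R / Num.sqrt delta * (F.[1] - F.[0]).
Proof.
move=> sp dF n0 s0 d0 d2 sd.
have pi0 := pi_gt0 R.
set x := acos (1 - 2 * delta).
have x_in : -1 <= 1 - 2 * delta <= 1 by apply/andP; split; lra.
have cx : cos x = 1 - 2 * delta by rewrite acosK// in_itv/=.
have x0 : 0 < x by apply: acos_gt0; apply/andP; split; lra.
have xpi : x <= pi by exact: acos_lepi.
have /andP[mle ltm] := truncn_itv (ltW (divr_gt0 pi0 x0)).
set m := Num.truncn (pi / x) in mle ltm.
have m0 : (0 < m)%N.
  have h1 : 1 <= pi / x by rewrite ler_pdivlMr// mul1r.
  by rewrite lt0n; apply: contraTneq ltm => ->; rewrite -leNgt.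
have m1 : 1 <= m%:R :> R by rewrite ler1n.
have mx_le : m%:R * x <= pi by rewrite -ler_pdivlMr.
(* As [m >= 1], [pi < (m + 1) x <= 2 m x]. Hence [m x] lies in [[pi/2, pi]], where the cosine is
   nonpositive. *)
have mx_ge : pi / 2 <= m%:R * x.
  rewrite ltr_pdivrMr// -natr1 mulrDl mul1r in ltm.
  have : x <= m%:R * x by rewrite ler_peMl// ltW.
  by move=> ?; lra.
have cmx : cos (m%:R * x) <= 0.
  have -> : m%:R * x = (m%:R * x - pi) + pi by ring.
  by rewrite cosDpi oppr_le0 cos_ge0_pihalf//; apply/andP; split; lra.
have := horner_cos_sqr_le x sp dF m0.
set c := _ / pi; set I := F.[1] - F.[0] => H.
have c0 : 0 < c.
  by rewrite divr_gt0// mulr_gt0 ?ltr0n// mulr_gt0// ltr0n.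
have hx : (1 - cos x) / 2 = delta by rewrite cx; field.
have hx' : (1 + cos x) / 2 = 1 - delta by rewrite cx; field.
rewrite hx hx' in H.
have H4 : p.[delta] ^+ 2 / 4 <= c * I.
  rewrite (le_trans _ H)// ler_wpM2l ?sqr_ge0//.
  have -> : 4^-1 = 2^-1 * 2^-1 :> R by field.
  by apply: ler_pM => //; lra.
have I0 : 0 <= I.
  by rewrite -(pmulr_rge0 _ c0) (le_trans _ H4)// divr_ge0// sqr_ge0.
set t := Num.sqrt delta; set u := Num.sqrt sigma.
have t0 : 0 < t by rewrite sqrtr_gt0.
have u0 : 0 < u by rewrite sqrtr_gt0.
have n0' : 0 < n%:R :> R by rewrite ltr0n.
have n1' : 1 <= n%:R :> R by rewrite ler1n.
(* Since [delta = sin(x/2)^2], this is the inequality [sin y <= y] at [y = x / 2]. *)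
have tx : t <= x / 2.
  rewrite -(ler_pXn2r (n:=2))// ?nnegrE ?(ltW t0) ?divr_ge0 ?(ltW x0)//.
  rewrite sqr_sqrtr ?(ltW d0)//.
  have -> : delta = sin (x / 2) ^+ 2.
    rewrite sin2cos2 -hx; have -> : cos x = cos ((x / 2) *+ 2).
      by congr cos; rewrite -mulr_natr; field.
    by rewrite cos_mulr2n; field.
  have sx0 : 0 <= sin (x / 2) by apply: sin_ge0_pi; apply/andP; split; lra.
  by rewrite ler_sqr ?nnegrE ?sin_le_id// divr_ge0// (ltW x0).
have tn : t^-1 <= n%:R / u.
  rewrite ler_pdivlMr// mulrC ler_pdivrMr//.
  rewrite -(ler_pXn2r (n:=2)) ?nnegrE ?(ltW u0) ?mulr_ge0 ?(ltW t0)//.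
  by rewrite exprMn !sqr_sqrtr ?(ltW d0) ?(ltW s0)// mulrC ltW// -ltr_pdivrMr// exprn_gt0.
have mt : m%:R <= pi / (2 * t).
  rewrite (le_trans mle)// ler_wpM2l ?(ltW pi0)// lef_pV2 ?posrE ?mulr_gt0//.
  by lra.
have pi4 : pi <= 4 :> R by have := pihalf_lt2 R; lra.
have mn : m%:R <= 2 * (n%:R / u).
  apply: (le_trans mt).
  have -> : pi / (2 * t) = pi / 2 * t^-1 by field; rewrite gt_eqF.
  by apply: ler_pM => //; rewrite ?invr_ge0 ?(ltW t0)//; lra.
(* One factor of [4 c] is bounded by [m <= pi / (2 t)], the other, [n + m + 1], by [m <= 2 n / u]
   and [1 <= n]. *)
have : 4 * c * I <= 8 * (1 + u^-1) * n%:R / t * I.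
  apply: ler_wpM2r => //.
  have -> : 4 * c = (8 / pi * m%:R) * (n%:R + m%:R + 1).
    suff key (q a b : R) : 4 * (2 * a * b / q) = 8 / q * a * b.
      by rewrite /c key -natrD natr1.
    by rewrite !mulrA (mulrAC _ q^-1) (mulrAC _ q^-1) -natrM.
  have -> : 8 * (1 + u^-1) * n%:R / t =
      (8 / pi * (pi / (2 * t))) * (2 * n%:R + 2 * (n%:R / u)).
    suff key (q w z a : R) : 0 < q -> 0 < w -> 0 < z ->
        8 * (1 + z^-1) * a / w = (8 / q * (q / (2 * w))) * (2 * a + 2 * (a / z)).
      exact: key.
    by move=> q0 w0 z0; field; rewrite !gt_eqF.
  apply: ler_pM.
  - by rewrite mulr_ge0// divr_ge0// ltW.
  - by lra.
  - by apply: ler_wpM2l => //; rewrite divr_ge0// ltW.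
  - by lra.
by move=> ?; lra.
Qed.

Lemma poly_primitive p : exists F : {poly R}, F^`() = p.
Proof.
exists (\poly_(i < (size p).+1) (p`_i.-1 / i%:R)); apply/polyP => i.
rewrite coef_deriv coef_poly ltnS; case: ltnP => [ip|pi].
  by rewrite -[LHS]mulr_natr divfK// pnatr_eq0.
by rewrite mul0rn nth_default.
Qed.

Lemma integral_horner F p a b : a < b -> F^`() = p ->
  (\int[@lebesgue_measure R]_(x in `[a, b]) (p.[x])%:E = (F.[b] - F.[a])%:E)%E.
Proof.
move=> ab dF; rewrite EFinB; apply: continuous_FTC2 => //.
- by apply: continuous_subspaceT; exact: continuous_horner.
- split=> [x _||]; first exact: derivable_horner.
  + by apply: cvg_at_right_filter; exact: continuous_horner.
  + by apply: cvg_at_left_filter; exact: continuous_horner.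
- by move=> x _; rewrite -derivE dF.
Qed.

(** The substitution [s -> c + e s] in [poly_sqr_le]. A negative [e] measures [delta] downwards from
    [c]; the division by [e] makes the last factor the mean of [p^2] for either sign. *)
Lemma horner_affine_sqr_le p F (n : nat) (sigma delta c e : R) :
  (size p <= n.+1)%N -> F^`() = p ^+ 2 -> (0 < n)%N -> 0 < sigma ->
  0 < delta -> delta <= 1 / 2 -> sigma * n%:R ^- 2 < delta -> e != 0 ->
  p.[c + e * delta] ^+ 2 <=
  8 * (1 + (Num.sqrt sigma)^-1) * n%:R / Num.sqrt delta
  * ((F.[c + e] - F.[c]) / e).
Proof.
move=> sp dF n0 s0 d0 d2 sd e0.
pose l : {poly R} := e *: 'X + c%:P.
have lE y : l.[y] = c + e * y by rewrite /l !hornerE addrC.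
have sl : (size l <= 2)%N.
  rewrite (leq_trans (size_polyD _ _))// geq_max.
  rewrite (leq_trans (size_scale_leq _ _)) ?size_polyX//.
  by rewrite size_polyC; case: (c != 0).
have spl : (size (p \Po l) <= n.+1)%N.
  rewrite (leq_trans (size_comp_poly_leq _ _))// ltnS.
  have : ((size p).-1 * (size l).-1 <= (size p).-1 * 1)%N by rewrite leq_mul2l; lia.
  lia.
have dFl : (e^-1 *: (F \Po l))^`() = (p \Po l) ^+ 2.
  rewrite derivZ deriv_comp dF !expr2 comp_polyM /l derivD derivC addr0 derivZ derivX.
  by rewrite -scalerAr mulr1 scalerA mulVf// scale1r.
have := poly_sqr_le spl dFl n0 s0 d0 d2 sd.
rewrite !hornerZ !horner_comp !lE mulr0 addr0 mulr1 => /le_trans; apply.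
by rewrite -mulrBr [e^-1 * _]mulrC.
Qed.

Lemma ge_top_integral_sqr p (n : nat) (sigma delta t : R) :
  (size p <= n.+1)%N -> (0 < n)%N -> 0 < sigma ->
  0 < delta -> delta <= 1 / 2 -> sigma * n%:R ^- 2 < delta ->
  ((p.[t - delta] ^+ 2)%:E <=
   (8 * (1 + (Num.sqrt sigma)^-1) * n%:R / Num.sqrt delta)%:E *
   \int[@lebesgue_measure R]_(x in `[(t - 1)%R, t]) (p.[x] ^+ 2)%:E)%E.
Proof.
move=> sp n0 s0 d0 d2 sd.
have [F dF] := poly_primitive (p ^+ 2).
under eq_integral do rewrite -horner_exp.
rewrite (integral_horner _ dF); last by rewrite ltrBlDr ltrDl.
rewrite -EFinM lee_fin.
have e0 : (-1 : R) != 0 by rewrite oppr_eq0 oner_eq0.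
have := horner_affine_sqr_le t sp dF n0 s0 d0 d2 sd e0.
by rewrite mulN1r invrN1 mulrN1 opprB.
Qed.

(** The midpoint is relative depth 1/2, so [sigma = 1/4] is admissible for every [n >= 1]. Then
    [8 (1 + 2) = 24], and [1 / sqrt(1/2) <= 2] is absorbed by the interval length [2 b]. *)
Lemma ge_center_integral_sqr p (n : nat) a b :
  (size p <= n.+1)%N -> (0 < n)%N -> 0 < b ->
  ((p.[a] ^+ 2)%:E <=
   (24 * n%:R / b)%:E *
   \int[@lebesgue_measure R]_(x in `[(a - b)%R, (a + b)%R]) (p.[x] ^+ 2)%:E)%E.
Proof.
move=> sp n0 b0.
have [F dF] := poly_primitive (p ^+ 2).
under eq_integral do rewrite -horner_exp.
rewrite (integral_horner _ dF); last by lra.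
rewrite -EFinM lee_fin.
have n1 : 1 <= n%:R :> R by rewrite ler1n.
have sd : 4^-1 * n%:R ^- 2 < 1 / 2 :> R.
  have : n%:R ^- 2 <= 1 :> R by rewrite invf_le1 ?exprn_gt0 ?ltr0n// exprn_ege1.
  by move=> ?; lra.
have q0 : 0 < 4^-1 :> R by [].
have h0 : 0 < 1 / 2 :> R by lra.
have b20 : 2 * b != 0 by rewrite mulf_neq0// gt_eqF.
have := horner_affine_sqr_le (a - b) sp dF n0 q0 h0 (lexx _) sd b20.
have -> : a - b + 2 * b * (1 / 2) = a by field.
have -> : a - b + 2 * b = a + b by ring.
have -> : Num.sqrt 4^-1 = 2^-1 :> R.
  by rewrite (_ : 4^-1 = 2^-1 ^+ 2) ?sqrtr_sqr ?ger0_norm//; field.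
have s2 : 2^-1 <= Num.sqrt (1 / 2) :> R.
  rewrite -(ler_pXn2r (n:=2)) ?nnegrE ?sqrtr_ge0 ?invr_ge0//.
  by rewrite sqr_sqrtr; lra.
have s0 : 0 < Num.sqrt (1 / 2) :> R by rewrite (lt_le_trans _ s2).
rewrite invrK; set J := _ / (2 * b) => H.
have c0 : 0 < 8 * (1 + 2) * n%:R / Num.sqrt (1 / 2) :> R.
  by rewrite divr_gt0// mulr_gt0// ltr0n.
have J0 : 0 <= J by rewrite -(pmulr_rge0 _ c0) (le_trans (sqr_ge0 _) H).
rewrite (le_trans H)//.
have -> : 24 * n%:R / b * (F.[a + b] - F.[a - b]) = 24 * n%:R * 2 * J.
  by rewrite /J; field; rewrite gt_eqF.
have -> : 8 * (1 + 2) * n%:R = 24 * n%:R :> R by ring.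
apply: ler_wpM2r => //; apply: ler_wpM2l; first by rewrite mulr_ge0.
by rewrite -[leRHS]invrK lef_pV2// posrE.
Qed.

End UnivariateChristoffelIntegral.

(** * Integration on row vectors *)

Section IntegrationRowVectors.
Context {R : realType}.
Local Open Scope ereal_scope.

Section Fubini.
Variables (n : nat) (f : 'rV[R]_n.+1 -> \bar R).
Hypotheses (mf : measurable_fun [set: 'rV[R]_n.+1] f) (f0 : forall y, 0 <= f y).

Let mfcons : measurable_fun setT (fun x => f (@rV_cons R n x)).
Proof. by apply: measurableT_comp => //; exact: measurable_rV_cons. Qed.

Lemma ge0_integral_rV_cons1 : \int[lebesgue_rV n.+1]_y f y =
  \int[@lebesgue_measure R]_t \int[lebesgue_rV n]_z f (rV_cons (t, z)).
Proof.
rewrite /= ge0_integral_pushforward//; last exact: measurable_rV_cons.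
by rewrite preimage_setT fubini_tonelli1//= => x; exact: f0.
Qed.

Lemma ge0_integral_rV_cons2 : \int[lebesgue_rV n.+1]_y f y =
  \int[lebesgue_rV n]_z \int[@lebesgue_measure R]_t f (rV_cons (t, z)).
Proof.
rewrite /= ge0_integral_pushforward//; last exact: measurable_rV_cons.
by rewrite preimage_setT fubini_tonelli2//= => x; exact: f0.
Qed.

Lemma measurable_integral_rV_cons1 :
  measurable_fun setT (fun t => \int[lebesgue_rV n]_z f (rV_cons (t, z))).
Proof.
by apply: (@measurable_fun_fubini_tonelli_F _ _ _ _ _ (lebesgue_rV n)
  (fun x => f (@rV_cons R n x))) => // x; exact: f0.
Qed.

Lemma measurable_integral_rV_cons2 :
  measurable_fun [set: 'rV[R]_n] (fun z => \int[@lebesgue_measure R]_t f (rV_cons (t, z))).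
Proof.
by apply: (@measurable_fun_fubini_tonelli_G _ _ _ _ _ (@lebesgue_measure R)
  (fun x => f (@rV_cons R n x))) => // x; exact: f0.
Qed.

End Fubini.
End IntegrationRowVectors.

(** * Point evaluation at the centre of a cube *)

Section PolynomialAlongLines.
Context {R : realType}.

(** Degree at most [N] expressed through restrictions to lines, so that the sheared polynomial need
    not be written as a multivariate one. *)
Definition poly_along_lines (N n : nat) (g : 'rV[R]_n -> R) :=
  forall z w, exists2 p : {poly R}, (size p <= N.+1)%N &
    forall t, g (z + t *: w) = p.[t].

Definition cube n (c : 'rV[R]_n) (b : R) : set 'rV[R]_n :=
  [set z | forall i, `|z 0 i - c 0 i| <= b].

Lemma measurable_cube n (c : 'rV[R]_n) b : measurable (cube c b).
Proof.
rewrite (_ : cube c b =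
    \bigcap_(i in [set: 'I_n]) (Defs.coord i @^-1` `[c 0 i - b, c 0 i + b])).
  apply: fin_bigcap_measurable => // i _; rewrite -[X in measurable X]setTI.
  exact: measurable_coord.
by apply/seteqP; split=> z zb i => [_|]; have := zb i;
  rewrite /Defs.coord /= in_itv/= -ler_distl//; apply.
Qed.

Lemma rV_consD n (s t : R) (z w : 'rV[R]_n) :
  rV_cons (s + t, z + w) = rV_cons (s, z) + rV_cons (t, w).
Proof.
by apply/rowP => i; rewrite !mxE; case: unlift => [j|] //=; rewrite mxE.
Qed.

Lemma rV_consZ n (s t : R) (w : 'rV[R]_n) :
  rV_cons (s * t, s *: w) = s *: rV_cons (t, w).
Proof.
by apply/rowP => i; rewrite !mxE; case: unlift => [j|] //=; rewrite mxE.
Qed.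

Lemma measurable_rV_consr n (t : R) :
  measurable_fun [set: 'rV[R]_n] (fun z : 'rV[R]_n => rV_cons (t, z)).
Proof.
apply: (measurableT_comp (@measurable_rV_cons R n)).
exact: measurable_pair1.
Qed.

(** The midpoint bound, one coordinate at a time: it is applied along the first axis through the
    centre, and the induction hypothesis bounds each value on that axis by an integral over the
    slice. In dimension 0 the measure is a unit mass. *)
Lemma ge_cube_integral_sqr N n (c : 'rV[R]_n) b (g : 'rV[R]_n -> R) :
  (0 < N)%N -> 0 < b -> poly_along_lines N g -> measurable_fun [set: 'rV[R]_n] g ->
  ((g c ^+ 2)%:E <= ((24 * N%:R / b) ^+ n)%:E *
    \int[lebesgue_rV n]_(z in cube c b) (g z ^+ 2)%:E)%E.
Proof.
move=> N0 b0; elim: n c g => [|n IH] c g pg mg.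
  rewrite expr0 mul1e integral_dirac; [|exact: measurable_cube|].
    by rewrite diracE mem_set ?mul1e ?(thinmx0 c)//= => -[].
  by apply/measurable_EFinP; apply: measurable_funTS; exact: measurable_funX.
pose c0 := c 0 ord0; pose c' := \row_j c 0 (lift ord0 j).
have cE : c = rV_cons (c0, c').
  by apply/rowP => i; rewrite mxE; case: unliftP => [j|] -> //=; rewrite mxE.
set K := 24 * N%:R / b in IH *.
have K0 : 0 < K by rewrite divr_gt0// mulr_gt0// ltr0n.
pose F y := (((fun y => (g y ^+ 2)%:E) \_ (cube c b)) y : \bar R).
have mF : measurable_fun [set: 'rV[R]_n.+1] F.
  apply/(measurable_restrictT _ (measurable_cube c b)).
  apply/measurable_EFinP; apply: measurable_funTS; exact: measurable_funX.
have F0 y : (0 <= F y)%E.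
  by apply: erestrict_ge0 => z _; rewrite lee_fin sqr_ge0.
rewrite integral_mkcond -/F ge0_integral_rV_cons1//.
pose H t := (\int[lebesgue_rV n]_z F (rV_cons (t, z)))%E.
have mH : measurable_fun setT H by exact: measurable_integral_rV_cons1.
have H0 t : (0 <= H t)%E by apply: integral_ge0 => z _; exact: F0.
have HE t : `|t - c0| <= b -> H t =
    (\int[lebesgue_rV n]_(z in cube c' b) (g (rV_cons (t, z)) ^+ 2)%:E)%E.
  move=> tb; rewrite /H [RHS]integral_mkcond; apply: eq_integral => z _.
  rewrite /F /patch; congr (if _ then _ else _).
  apply/idP/idP; rewrite !inE => zb i.
    by have := zb (lift ord0 i); rewrite !mxE liftK.
  by rewrite cE !mxE; case: unliftP => [j|] _ //=; exact: zb.
have stepn t : `|t - c0| <= b ->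
    ((g (rV_cons (t, c')) ^+ 2)%:E <= (K ^+ n)%:E * H t)%E.
  move=> tb; rewrite HE//; apply: (IH c' (fun z => g (rV_cons (t, z)))).
    move=> z w; have [p sp pE] := pg (rV_cons (t, z)) (rV_cons (0, w)).
    exists p => // s; rewrite -pE -rV_consZ -rV_consD.
    by rewrite mulr0 addr0.
  by apply: measurableT_comp => //; exact: measurable_rV_consr.
have [p sp pE] := pg (rV_cons (0, c')) (rV_cons (1, 0)).
have pE' t : g (rV_cons (t, c')) = p.[t].
  by rewrite -pE -rV_consZ mulr1 scaler0 -rV_consD add0r addr0.
rewrite [in leLHS]cE pE'.
apply: (le_trans (ge_center_integral_sqr c0 sp N0 b0)).
rewrite -/K exprS (EFinM K) -muleA; apply: lee_wpmul2l; first by rewrite lee_fin ltW.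
apply: (@le_trans _ _ (\int[@lebesgue_measure R]_(t in `[(c0 - b)%R, (c0 + b)%R])
    ((K ^+ n)%:E * H t))%E).
  apply: ge0_le_integral => //.
  - by move=> t _; rewrite lee_fin sqr_ge0.
  - apply/measurable_EFinP; apply: measurable_funTS; apply: measurable_funX.
    by apply: continuous_measurable_fun; exact: continuous_horner.
  - by apply: measurable_funTS; exact: measurable_funeM.
  - by move=> t; rewrite /= in_itv/= -ler_distl => tb; rewrite -pE'; exact: stepn.
have Kn0 : (0 <= K ^+ n) by rewrite exprn_ge0// ltW.
rewrite ge0_integralZl_EFin//; last exact: measurable_funTS.
apply: lee_wpmul2l; first by rewrite lee_fin.
exact: ge0_subset_integral.
Qed.

End PolynomialAlongLines.

(** * Polynomials in several variables *)

Section MultivariatePolynomials.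
Context {R : realType} {d : nat}.
Implicit Types (p q : mpoly d R) (m : multinom d).

Lemma pevalE p x :
  peval p x = \sum_(m <- msupp p) mcoeff m p * \prod_i x 0 i ^+ m i.
Proof. by rewrite /peval mevalE. Qed.

Lemma pevalD p q x : peval (p + q) x = peval p x + peval q x.
Proof. exact: mevalD. Qed.

Lemma pevalZ (c : R) p x : peval (c *: p) x = c * peval p x.
Proof. exact: mevalZ. Qed.

Lemma pevalM p q x : peval (p * q) x = peval p x * peval q x.
Proof. exact: mevalM. Qed.

Lemma polys_of_degree_le_linear (n : nat) (a : R) p q :
  polys_of_degree_le n p -> polys_of_degree_le n q ->
  polys_of_degree_le n (a *: p + q).
Proof.
rewrite /polys_of_degree_le /= => pn qn.
rewrite (leq_trans (msizeD_le _ _))// geq_max qn andbT.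
by rewrite (leq_trans (msizeZ_le _ _)).
Qed.

Lemma mdeg_le (n : nat) p m :
  polys_of_degree_le n p -> m \in msupp p -> (\sum_i m i <= n)%N.
Proof.
move=> pn mp; rewrite -mdegE -ltnS (leq_trans _ pn)//; exact: msize_mdeg_lt.
Qed.

(** Used with [k = 1] for lines and with [k = 2] for the parabolas into which the shear bends
    lines. *)
Lemma peval_curve p (n k : nat) (q : 'I_d -> {poly R}) :
  polys_of_degree_le n p -> (forall i, (size (q i) <= k.+1)%N) ->
  exists2 P : {poly R}, (size P <= (k * n).+1)%N &
    forall t, peval p (\row_i (q i).[t]) = P.[t].
Proof.
move=> pn qk.
have sX (r : {poly R}) (e : nat) : (size r <= k.+1)%N -> (size (r ^+ e) <= (k * e).+1)%N.
  move=> rk; elim: e => [|e IH]; first by rewrite expr0 size_poly1.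
  by rewrite exprS mulnS; exact: size_polyM_le.
exists (\sum_(m <- msupp p) mcoeff m p *: \prod_i q i ^+ m i); last first.
  move=> t; rewrite pevalE horner_sum; apply: eq_bigr => m _.
  rewrite hornerZ horner_prod; congr (_ * _); apply: eq_bigr => i _.
  by rewrite mxE horner_exp.
rewrite (leq_trans (size_sum _ _ _))//; apply/bigmax_leqP_seq => m mp _.
rewrite (leq_trans (size_scale_leq _ _))//.
have : (k * (\sum_i m i) <= k * n)%N by rewrite leq_mul2l (mdeg_le pn mp) orbT.
rewrite -ltnS; apply: leq_trans; rewrite big_distrr/=.
elim/big_rec2 : _ => [|i a P _ IH]; first by rewrite size_poly1.
exact: size_polyM_le (sX _ _ (qk i)) IH.
Qed.

Lemma measurable_peval p : measurable_fun [set: 'rV[R]_d] (peval p).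
Proof.
rewrite (_ : peval p = fun x => \sum_(m <- msupp p) mcoeff m p * \prod_i x 0 i ^+ m i).
  apply: measurable_sum => m; apply: measurable_funM => //.
  apply: measurable_prod => i _; apply: measurable_funX.
  exact: measurable_coord.
by apply/funext => x; rewrite pevalE.
Qed.

Lemma peval_bounded p (b : R) :
  exists B, forall x, cube 0 b x -> `|peval p x| <= B.
Proof.
exists (\sum_(m <- msupp p) `|mcoeff m p| * \prod_i b ^+ m i) => x xb.
rewrite pevalE (le_trans (ler_norm_sum _ _ _))//; apply: ler_sum => m _.
rewrite normrM ler_wpM2l// normr_prod; apply: ler_prod => i _.
rewrite normr_ge0 normrX lerXn2r ?nnegrE//.
  by rewrite (le_trans (normr_ge0 _) (xb i)).
by have := xb i; rewrite mxE subr0.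
Qed.

(** Uniqueness of base [N] digits: reduction modulo [N] gives the lowest one, induction the
    others. *)
Lemma digits_inj (N e : nat) (a b : 'I_e -> nat) :
  (forall i, (a i < N)%N) -> (forall i, (b i < N)%N) ->
  (\sum_i a i * N ^ i = \sum_i b i * N ^ i)%N -> a =1 b.
Proof.
elim: e a b => [|e IH] a b aN bN; first by move=> _ [].
have shift (c : 'I_e.+1 -> nat) :
    (\sum_i c i * N ^ i = (\sum_(i < e) c (lift ord0 i) * N ^ i) * N + c ord0)%N.
  rewrite big_ord_recl expn0 muln1 addnC big_distrl/=; congr (_ + _)%N.
  by apply: eq_bigr => i _; rewrite -mulnA -expnSr.
rewrite !shift => eq_ab.
have N0 : (0 < N)%N by rewrite (leq_trans _ (aN ord0)).
have ab0 : a ord0 = b ord0.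
  by have := congr1 (modn^~ N) eq_ab; rewrite /= !modnMDl !modn_small.
move: eq_ab; rewrite ab0 => /addIn /eqP; rewrite eqn_pmul2r// => /eqP /IH abS i.
case: (unliftP ord0 i) => [j ->|->//]; apply: abS => //.
Qed.

(* Kronecker substitution x_i := t^(N^i) sends distinct monomials to distinct
   powers of t. *)
Lemma peval_eq0 p (c : R) : 0 < c -> c <= 1 ->
  (forall x, cube 0 c x -> peval p x = 0) -> p = 0.
Proof.
move=> c0 c1 px0.
(* Larger than every exponent in [p], so that the exponents of [m] are the base [N] digits of
   [w m]. *)
pose N := (msize p).+1.
pose w (m : multinom d) := (\sum_(i < d) m i * N ^ i)%N.
pose P : {poly R} := \sum_(m <- msupp p) mcoeff m p *: 'X^(w m).
have PE t : P.[t] = peval p (\row_i t ^+ (N ^ i)).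
  rewrite pevalE horner_sum; apply: eq_bigr => m _.
  rewrite hornerZ hornerXn; congr (_ * _).
  rewrite /w -prodrXr; apply: eq_bigr => i _.
  by rewrite mxE -exprM mulnC.
have P0 : P = 0.
  apply/eqP; apply: contraT => Pn0.
  (* As many distinct roots as the size of [P], which is one too many. They lie in [(0, c]] with
     [c <= 1], so their powers stay in the cube. *)
  pose rs := [seq c / (j.+1)%:R | j <- iota 0 (size P)].
  have rsP : all (root P) rs.
    apply/allP => _ /mapP[j _ ->]; apply/rootP; rewrite PE; apply: px0 => i.
    rewrite !mxE subr0.
    have t0 : 0 <= c / j.+1%:R by rewrite divr_ge0// ltW.
    have tc : c / j.+1%:R <= c by rewrite ler_pdivrMr// ler_peMr ?(ltW c0)// ler1n.
    rewrite ger0_norm ?exprn_ge0// (le_trans _ tc)//.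
    rewrite -[leRHS]expr1 ler_wiXn2l// ?(le_trans tc)//.
    by rewrite expn_gt0.
  have urs : uniq rs.
    rewrite map_inj_uniq ?iota_uniq// => j k /(mulfI (lt0r_neq0 c0)) /invr_inj.
    by move=> /eqP; rewrite eqr_nat => /eqP[].
  by have := max_poly_roots Pn0 rsP urs; rewrite size_map size_iota ltnn.
apply/mpolyP => m; rewrite mcoeff0.
case: (boolP (m \in msupp p)) => [mp|/memN_msupp_eq0//].
have /(congr1 (fun Q : {poly R} => Q`_(w m))) := P0.
rewrite coef0 coef_sum (bigD1_seq m)//= coefZ coefXn eqxx mulr1.
rewrite big1_seq ?addr0// => m' /andP[m'm m'p].
rewrite coefZ coefXn; case: eqP => [ww|_]; last by rewrite mulr0.
case/eqP: m'm; apply/mnmP; apply: (@digits_inj N) => //.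
- by move=> i; rewrite /N ltnS (leq_trans _ (ltnW (msize_mdeg_lt m'p)))// mdegE (bigD1 i)//= leq_addr.
- by move=> i; rewrite /N ltnS (leq_trans _ (ltnW (msize_mdeg_lt mp)))// mdegE (bigD1 i)//= leq_addr.
Qed.

End MultivariatePolynomials.

(** * The Christoffel function *)

Section GramSchmidt.
Context {R : realType} {V : lmodType R} (B : V -> V -> R).
Hypotheses (BC : forall u v, B u v = B v u)
  (BZD : forall a u v w, B (a *: u + v) w = a * B u w + B v w)
  (B_gt0 : forall v, v != 0 -> 0 < B v v).

Definition orthonormal_seq (phi : seq V) := forall i j,
  (i < size phi)%N -> (j < size phi)%N -> B phi`_i phi`_j = (i == j)%:R.

Definition in_span (phi : seq V) (v : V) :=
  exists c : nat -> R, v = \sum_(k < size phi) c k *: phi`_k.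

Lemma in_span_linear phi a u v :
  in_span phi u -> in_span phi v -> in_span phi (a *: u + v).
Proof.
move=> [c ->] [e ->]; exists (fun k => a * c k + e k).
rewrite scaler_sumr -big_split/=; apply: eq_bigr => k _.
by rewrite scalerDl scalerA.
Qed.

Lemma in_span_rcons phi w v : in_span phi v -> in_span (rcons phi w) v.
Proof.
move=> [c ->]; exists (fun k => if (k < size phi)%N then c k else 0).
rewrite size_rcons big_ord_recr/= ltnn scale0r addr0; apply: eq_bigr => k _.
by rewrite nth_rcons ltn_ord.
Qed.

Let B0l w : B 0 w = 0.
Proof.
have := BZD (-1) 0 0 w; rewrite scaler0 addr0 mulN1r => h.
by rewrite [LHS]h addNr.
Qed.

Lemma B_sumZl (n : nat) (c : 'I_n -> R) (u : 'I_n -> V) w :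
  B (\sum_(k < n) c k *: u k) w = \sum_(k < n) c k * B (u k) w.
Proof.
elim: n c u => [|n IH] c u; first by rewrite !big_ord0 B0l.
by rewrite big_ord_recl BZD IH [RHS]big_ord_recl.
Qed.

(** A vector whose residual after projection vanishes is skipped, so [S] may be linearly dependent.
    The predicate [P] carries the degree bound along. *)
Lemma gram_schmidt (S : seq V) (P : V -> Prop) : P 0 ->
  (forall a u v, P u -> P v -> P (a *: u + v)) ->
  (forall s, s \in S -> P s) ->
  exists phi : seq V, [/\ orthonormal_seq phi,
    forall k, (k < size phi)%N -> P phi`_k &
    forall s, s \in S -> in_span phi s].
Proof.
move=> P0 Plin; elim/last_ind: S => [|S s IH] PS.
  by exists [::]; split.
have [s' s'S|phi [ophi Pphi spanS]] := IH.
  by apply: PS; rewrite mem_rcons inE s'S orbT.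
pose proj := \sum_(k < size phi) B s phi`_k *: phi`_k.
have Pproj : P proj.
  rewrite /proj; elim/big_rec : _ => // k v _ Pv.
  exact: Plin (Pphi _ (ltn_ord k)) Pv.
pose r := (-1) *: proj + s.
have Pr : P r by apply: Plin => //; apply: PS; rewrite mem_rcons mem_head.
have sE : s = proj + r by rewrite /r scaleN1r addNKr.
have orth j : (j < size phi)%N -> B r phi`_j = 0.
  move=> js; rewrite /r BZD B_sumZl (bigD1 (Ordinal js))//= ophi// eqxx mulr1.
  rewrite big1 ?addr0 ?mulN1r ?addNr// => k kj.
  rewrite ophi// (_ : (k == j :> nat) = false) ?mulr0//.
  by apply: contraNF kj => /eqP kj; apply/eqP/val_inj.
have spanproj : in_span phi proj by exists (fun k => B s phi`_k).
have [r0|rn0] := eqVneq r 0.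
  exists phi; split=> // s'; rewrite mem_rcons inE => /predU1P[->|/spanS//].
  by rewrite sE r0 addr0.
have Br := B_gt0 rn0.
pose e := Num.sqrt (B r r).
have e0 : 0 < e by rewrite sqrtr_gt0.
pose f := e^-1 *: r.
have BZl a u w : B (a *: u) w = a * B u w by rewrite -[a *: u]addr0 BZD B0l addr0.
have forth j : (j < size phi)%N -> B f phi`_j = 0.
  by move=> js; rewrite BZl orth// mulr0.
have ff : B f f = 1.
  rewrite BZl BC BZl mulrA -invfM -expr2 sqr_sqrtr ?(ltW Br)// mulVf//.
  by rewrite gt_eqF.
exists (rcons phi f); split.
- have lt_size i : (i <= size phi)%N -> i != size phi -> (i < size phi)%N.
    by move=> iS ineq; rewrite ltn_neqAle ineq.
  move=> i j; rewrite size_rcons !ltnS !nth_rcons => iS jS.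
  have [->|/(lt_size _ iS) {}iS] := eqVneq i (size phi);
    have [->|/(lt_size _ jS) {}jS] := eqVneq j (size phi).
  + by rewrite ltnn ff.
  + by rewrite ltnn jS forth// gtn_eqF.
  + by rewrite ltnn iS BC forth// ltn_eqF.
  + by rewrite iS jS ophi.
- move=> k; rewrite size_rcons ltnS leq_eqVlt nth_rcons => /predU1P[->|kS].
    by rewrite ltnn eqxx -[f]addr0; exact: Plin.
  by rewrite kS; exact: Pphi.
- move=> s'; rewrite mem_rcons inE => /predU1P[->|/spanS]; last exact: in_span_rcons.
  rewrite sE (_ : proj + r = e *: f + proj).
    apply: in_span_linear; last exact: in_span_rcons.
    exists (fun k => (k == size phi)%:R); rewrite size_rcons big_ord_recr/=.
    rewrite nth_rcons ltnn eqxx scale1r big1 ?add0r// => k _.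
    by rewrite ltn_eqF// scale0r.
  by rewrite /f scalerA mulfV ?gt_eqF// scale1r addrC.
Qed.

End GramSchmidt.

(** * Volumes of products and cubes *)

Section CubeVolume.
Context {R : realType}.

Lemma lebesgue_rV_cons (n : nat) (A : set (measurableTypeR R))
    (B : set 'rV[R]_n) (E : set 'rV[R]_n.+1) :
  measurable A -> measurable B -> @rV_cons R n @^-1` E = A `*` B ->
  lebesgue_rV n.+1 E = (@lebesgue_measure R A * lebesgue_rV n B)%E.
Proof.
by move=> mA mB EAB; rewrite /= /lebesgue_step /pushforward EAB product_measure1E.
Qed.

Lemma lebesgue_cube n (c : 'rV[R]_n) b : 0 <= b ->
  lebesgue_rV n (cube c b) = ((2 * b) ^+ n)%:E.
Proof.
move=> b0; elim: n c => [|n IH] c.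
  by rewrite /= diracE mem_set// => -[].
rewrite (@lebesgue_rV_cons n `[c 0 ord0 - b, c 0 ord0 + b]
  (cube (\row_j c 0 (lift ord0 j)) b)) //.
- rewrite IH lebesgue_measure_itv/= lte_fin.
  case: ltP => [_|b0'].
    by rewrite EFinN -EFinD -EFinM exprS; congr (_ * _)%:E; ring.
  have -> : b = 0 by lra.
  by rewrite mul0e mulr0 expr0n.
- exact: measurable_cube.
- apply/seteqP; split=> -[t z] /=.
    move=> h; split=> [|i].
      by have := h ord0; rewrite mxE unlift_none/= in_itv/= -ler_distl.
    by have := h (lift ord0 i); rewrite !mxE liftK.
  rewrite in_itv/= -ler_distl => -[h1 h2] i; rewrite mxE.
  by case: unliftP => [j|] -> //=; have := h2 j; rewrite !mxE.
Qed.

End CubeVolume.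

(** * Lower bounds for the Christoffel function by point evaluation *)

Section ChristoffelBound.
Context {R : realType} {d : nat} (D : set 'rV[R]_d) (b c : R).
Hypotheses (mD : measurable D) (b0 : 0 <= b) (Db : D `<=` cube 0 b)
  (c0 : 0 < c) (c1 : c <= 1) (cD : cube 0 c `<=` D).
Implicit Types p q : mpoly d R.

Lemma poly_along_lines_peval p : poly_along_lines (msize p) (peval p).
Proof.
move=> z w; pose q (i : 'I_d) : {poly R} := w 0 i *: 'X + (z 0 i)%:P.
have q2 i : (size (q i) <= 2)%N.
  rewrite (leq_trans (size_polyD _ _))// geq_max (leq_trans (size_scale_leq _ _)) ?size_polyX//.
  by rewrite size_polyC; case: (_ != _).
have pn : polys_of_degree_le (msize p) p by rewrite /polys_of_degree_le /=.
have [P sP PE] := peval_curve pn q2.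
exists P; first by rewrite mul1n in sP.
move=> t; rewrite -PE; congr peval; apply/rowP => i.
by rewrite !mxE /q !hornerE addrC mulrC.
Qed.

Lemma integrable_peval p : (lebesgue_rV d).-integrable D (EFin \o peval p).
Proof.
apply: measurable_bounded_integrable => //.
- apply: (@le_lt_trans _ _ (lebesgue_rV d (cube 0 b))).
    by apply: le_measure => //; rewrite inE//; exact: measurable_cube.
  by rewrite lebesgue_cube// ltry.
- by apply: measurable_funTS; exact: measurable_peval.
- have [B Bp] := peval_bounded p b.
  exists B; split; first exact: num_real.
  by move=> M BM x Dx /=; rewrite (le_trans (Bp _ (Db Dx)))// ltW.
Qed.

Lemma inner_productE p q :
  inner_product D p q = \int[lebesgue_rV d]_(y in D) peval (p * q) y.
Proof. by apply: eq_Rintegral => y _; rewrite pevalM. Qed.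

Lemma inner_productC p q : inner_product D p q = inner_product D q p.
Proof. by rewrite !inner_productE mulrC. Qed.

Lemma inner_product_linear (a : R) p q r :
  inner_product D (a *: p + q) r = a * inner_product D p r + inner_product D q r.
Proof.
rewrite !inner_productE mulrDl -scalerAl -RintegralZl//; last exact: integrable_peval.
rewrite -RintegralD//.
- by apply: eq_Rintegral => y _; rewrite pevalD pevalZ.
- rewrite (_ : _ \o _ = EFin \o peval (a *: (p * r))); first exact: integrable_peval.
  by apply/funext => y /=; rewrite pevalZ.
- exact: integrable_peval.
Qed.

Lemma integral_sqr_peval p :
  (\int[lebesgue_rV d]_(y in D) (peval p y ^+ 2)%:E = (inner_product D p p)%:E)%E.
Proof.
rewrite inner_productE /Rintegral fineK.
  by apply: eq_integral => y _; rewrite pevalM expr2.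
exact: integrable_fin_num (integrable_peval _).
Qed.

(** If the integral of [p^2] vanishes, [ge_cube_integral_sqr] forces [p = 0] at every point of the
    cube of half-side [c / 2], since the cube of that size about such a point still lies in [D].
    Then [peval_eq0] applies. *)
Lemma inner_product_gt0 p : p != 0 -> 0 < inner_product D p p.
Proof.
move=> pn0; rewrite lt_neqAle; apply/andP; split; last first.
  by apply: Rintegral_ge0 => y _; rewrite -expr2 sqr_ge0.
apply: contra pn0 => /eqP pp0; apply/eqP.
have c20 : 0 < c / 2 by rewrite divr_gt0.
apply: (@peval_eq0 _ _ _ (c / 2)) => //.
  by rewrite ler_pdivrMr// mul1r (le_trans c1)// ler1n.
move=> x xc; apply/eqP; rewrite -sqrf_eq0 eq_le sqr_ge0 andbT -lee_fin.
have N0 : (0 < (msize p).+1)%N by [].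
have lines : poly_along_lines (msize p).+1 (peval p).
  by move=> z w; have [P sP PE] := poly_along_lines_peval p z w; exists P => //; exact: leqW.
apply: (le_trans (ge_cube_integral_sqr x N0 c20 lines (measurable_peval p))).
apply: mule_ge0_le0.
  by rewrite lee_fin exprn_ge0// divr_ge0 ?(ltW c20)// mulr_ge0.
apply: (@le_trans _ _ (inner_product D p p)%:E); last by rewrite -pp0.
rewrite -integral_sqr_peval.
apply: ge0_subset_integral => //.
- exact: measurable_cube.
- by apply/measurable_EFinP; apply: measurable_funTS; apply: measurable_funX; exact: measurable_peval.
- by move=> y _; rewrite lee_fin sqr_ge0.
move=> y yc; apply: cD => i; rewrite mxE subr0.
have := xc i; rewrite mxE subr0 => xi.
by rewrite -[y 0 i](subrK (x 0 i)) (le_trans (ler_normD _ _))// (splitr c) lerD//; exact: yc.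
Qed.

Lemma orthonormal_basis_exists (n : nat) : exists N (phi : 'I_N -> mpoly d R),
  orthonormal_basis D n phi.
Proof.
(* The bound in [bmultinom] is strict: these are the monomials of degree at most [n]. *)
pose S : seq (mpoly d R) := [seq mpolyX R (bmnm m) | m <- enum {: bmultinom d n.+1}].
have SP s : s \in S -> polys_of_degree_le n s.
  move=> /mapP[m _ ->]; rewrite /polys_of_degree_le /= mmeasureX.
  exact: bmdeg.
have P0 : polys_of_degree_le n (0 : mpoly d R) by rewrite /polys_of_degree_le /= mmeasure0.
have [phi [ophi Pphi spanS]] := gram_schmidt inner_productC inner_product_linear
  inner_product_gt0 P0 (@polys_of_degree_le_linear R d n) SP.
exists (size phi), (fun k => phi`_k); split.
- by move=> k; exact: Pphi.
- by move=> i j; rewrite ophi.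
- move=> p pn; suff [e ->] : in_span phi p by exists e.
  rewrite [p]mpolyE.
  have : forall m, m \in msupp p -> in_span phi (mpolyX R m).
    move=> m mp; apply: spanS; apply/mapP.
    have mn : (mdeg m < n.+1)%N by rewrite (leq_trans (msize_mdeg_lt mp)).
    by exists (BMultinom mn); rewrite ?mem_enum.
  elim: (msupp p) => [_|m s IH ms]; first rewrite big_nil.
    by exists (fun=> 0); rewrite big1// => k _; rewrite scale0r.
  rewrite big_cons; apply: in_span_linear; first by apply: ms; rewrite mem_head.
  by apply: IH => m' m's; apply: ms; rewrite inE m's orbT.
Qed.

(** The test polynomial is the reproducing kernel [q] at [x]: both [q(x)] and its squared norm equal
    [S], the sum of the squares of the basis at [x]. The hypothesis reads [S^2 <= K S]. *)
Lemma christoffel_ge (n : nat) (x : 'rV[R]_d) (K : R) : 0 < K ->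
  (forall p, polys_of_degree_le n p ->
     peval p x ^+ 2 <= K * inner_product D p p) ->
  K^-1 <= christoffel D n x.
Proof.
move=> K0 Kx; rewrite /christoffel.
(* The default value 0 is ruled out by the existence of an orthonormal basis. *)
case: xgetP => [l _ [N [phi [[phin ophi phispan] ->]]]|]; last first.
  have [N [phi ophi]] := orthonormal_basis_exists n.
  by move=> /(_ (\sum_(k < N) peval (phi k) x ^+ 2)^-1) []; exists N, phi.
set S := \sum_(k < N) _.
have S0 : 0 <= S by apply: sumr_ge0 => k _; exact: sqr_ge0.
pose q := \sum_(k < N) peval (phi k) x *: phi k.
have peval_sum (a : 'I_N -> R) y :
    peval (\sum_(k < N) a k *: phi k) y = \sum_(k < N) a k * peval (phi k) y.
  by rewrite /peval raddf_sum; apply: eq_bigr => k _; exact: pevalZ.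
have qn : polys_of_degree_le n q.
  rewrite /q; elim/big_rec : _ => [|k v _ vn]; first by rewrite /polys_of_degree_le /= mmeasure0.
  exact: polys_of_degree_le_linear.
have qx : peval q x = S by rewrite peval_sum; apply: eq_bigr => k _; rewrite expr2.
have qq : inner_product D q q = S.
  rewrite (B_sumZl inner_product_linear); apply: eq_bigr => k _.
  rewrite inner_productC (B_sumZl inner_product_linear) (bigD1 k)//= ophi eqxx mulr1.
  by rewrite big1 ?addr0 ?expr2// => j /negPf jk; rewrite ophi jk mulr0.
(* Otherwise every basis element, hence also the constant 1 in their span, would vanish at [x]. *)
have Sneq0 : S != 0.
  apply/eqP => Seq0; have phix0 k : peval (phi k) x = 0.
    apply/eqP; rewrite -sqrf_eq0; move/eqP: Seq0.
    by rewrite psumr_eq0 => [/allP/(_ k)|j _]; [rewrite mem_index_enum; exact|exact: sqr_ge0].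
  have one_n : polys_of_degree_le n (1 : mpoly d R).
    by rewrite /polys_of_degree_le /= mmeasure1.
  have [a oneE] := phispan 1 one_n.
  have : peval (1 : mpoly d R) x = 0.
    by rewrite oneE peval_sum big1// => k _; rewrite phix0 mulr0.
  by rewrite /peval meval1 => /eqP; rewrite oner_eq0.
have Sgt0 : 0 < S by rewrite lt_neqAle eq_sym Sneq0.
rewrite lef_pV2 ?posrE//.
have := Kx _ qn; rewrite qx qq expr2 ler_pM2r//.
Qed.

End ChristoffelBound.

(** * Euclidean balls *)

Section Scaling.
Context {R : realType}.
Local Open Scope ereal_scope.
Let mu := @lebesgue_measure R.

Let mdiv (s : R) : measurable_fun [set: measurableTypeR R]
  ((fun t => s^-1 * t)%R : measurableTypeR R -> measurableTypeR R).
Proof. exact: measurable_funM. Qed.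

(** By uniqueness of Lebesgue measure: the pushforward under division by [s], multiplied by [1 / s],
    has the right value on half-open intervals. *)
Lemma lebesgue_measure_scale (s : R) (A : set (measurableTypeR R)) :
  (0 < s)%R -> measurable A ->
  mu ((fun t => s^-1 * t)%R @^-1` A) = s%:E * mu A.
Proof.
move=> s0 mA; have ms := mdiv s.
have si0 : (0 <= s^-1)%R by rewrite invr_ge0 ltW.
pose k' : {nonneg R} := NngNum si0.
pose phi : measurableTypeR R -> measurableTypeR R := fun t => (s^-1 * t)%R.
have muE X : measurable X -> mu X = pushforward (mscale k' mu) phi X.
  move=> mX; apply: lebesgue_measure_unique => //= _ [[a b] _ <-].
  rewrite /mscale /= /pushforward (_ : phi @^-1` _ = `](s * a)%R, (s * b)%R]%classic); last first.
    apply/seteqP; split=> t; rewrite /phi /= !in_itv/= => /andP[h1 h2]; apply/andP; split.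
    - by rewrite -ltr_pdivlMl.
    - by rewrite -ler_pdivrMl// invrK.
    - by rewrite ltr_pdivlMl.
    - by rewrite ler_pdivrMl.
  rewrite !lebesgue_measure_itv/= !lte_fin ltr_pM2l//.
  case: ifPn => _; last by rewrite mule0.
  rewrite -!EFinB -EFinM; congr (_%:E); field; rewrite gt_eqF//.
rewrite [in RHS]muE// /mscale /= muleA -EFinM mulfV ?gt_eqF// mul1e//.
Qed.

Lemma ge0_integral_scale (s : R) (H : R -> \bar R) : (0 < s)%R ->
  measurable_fun [set: measurableTypeR R] H -> (forall t, 0 <= H t) ->
  \int[mu]_t H (s^-1 * t)%R = s%:E * \int[mu]_t H t.
Proof.
move=> s0 mH H0; have ms := mdiv s.
pose k : {nonneg R} := NngNum (ltW s0).
have <- : \int[mscale k mu]_t H t = s%:E * \int[mu]_t H t.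
  by rewrite ge0_integral_mscale.
pose phi : measurableTypeR R -> measurableTypeR R := fun t => (s^-1 * t)%R.
transitivity (\int[pushforward mu phi]_t H t).
  by rewrite ge0_integral_pushforward.
apply: eq_measure_integral => B mB _.
exact: lebesgue_measure_scale.
Qed.

Lemma lebesgue_rV_section n (A : set 'rV[R]_n.+1) :
  lebesgue_rV n.+1 A =
  \int[mu]_t lebesgue_rV n [set z | A (rV_cons (t, z))].
Proof.
rewrite [LHS]/= /lebesgue_step /pushforward /product_measure1.
apply: eq_integral => t _ /=; congr (lebesgue_rV n _).
by apply/seteqP; split=> z; rewrite /xsection /= inE.
Qed.

Lemma measurable_rV_section n (A : set 'rV[R]_n.+1) : measurable A ->
  measurable_fun [set: measurableTypeR R]
    (fun t => lebesgue_rV n [set z | A (rV_cons (t, z))]).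
Proof.
move=> mA; rewrite (_ : (fun t => _) = lebesgue_rV n \o xsection (@rV_cons R n @^-1` A)).
  apply: measurable_fun_xsection; rewrite -[X in measurable X]setTI.
  exact: measurable_rV_cons.
apply/funext => t /=; congr (lebesgue_rV n _).
by apply/seteqP; split=> z; rewrite /xsection /= inE.
Qed.

Lemma lebesgue_rV_scale n (s : R) (A : set 'rV[R]_n) : (0 < s)%R -> measurable A ->
  lebesgue_rV n [set z | A (s^-1 *: z)%R] = (s ^+ n)%:E * lebesgue_rV n A.
Proof.
move=> s0; elim: n A => [|n IH] A mA.
  rewrite expr0 mul1e; congr (lebesgue_rV 0 _).
  by apply/seteqP; split=> z /=; rewrite (thinmx0 z) scaler0.
rewrite !lebesgue_rV_section.
pose H t := lebesgue_rV n [set z | A (rV_cons (t, z))].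
have mH : measurable_fun [set: measurableTypeR R] H by exact: measurable_rV_section.
transitivity (\int[mu]_t ((s ^+ n)%:E * H (s^-1 * t)%R)).
  apply: eq_integral => t _; rewrite /H -IH; last first.
    have := @measurable_rV_consr R n (s^-1 * t)%R measurableT A mA.
    by rewrite setTI.
  by congr (lebesgue_rV n _); apply/seteqP; split=> z /=; rewrite rV_consZ.
rewrite ge0_integralZl_EFin//; last 2 first.
- by apply: measurableT_comp => //; exact: mdiv.
- by rewrite exprn_ge0// ltW.
by rewrite ge0_integral_scale// muleA -EFinM exprSr.
Qed.

End Scaling.

(** * Volumes of Euclidean balls and of hyperplane sections *)

Section EuclideanBall.
Context {R : realType}.

Definition eball n (r : R) : set 'rV[R]_n := [set z | dotv z z <= r ^+ 2].

Lemma dotv_ge0 n (z : 'rV[R]_n) : 0 <= dotv z z.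
Proof. by apply: sumr_ge0 => i _; rewrite -expr2 sqr_ge0. Qed.

Lemma sqr_le_dotv n (z : 'rV[R]_n) i : z 0 i ^+ 2 <= dotv z z.
Proof.
rewrite /dotv (bigD1 i)//= -expr2 lerDl; apply: sumr_ge0 => j _.
by rewrite -expr2 sqr_ge0.
Qed.

Lemma measurable_dotv n : measurable_fun [set: 'rV[R]_n] (fun z : 'rV[R]_n => dotv z z).
Proof.
apply: measurable_sum => i; apply: measurable_funM; exact: measurable_coord.
Qed.

Lemma measurable_eball n (r : R) : measurable (@eball n r).
Proof.
have := @measurable_dotv n measurableT _ (measurable_itv `]-oo, (r ^+ 2)%R]).
by rewrite setTI.
Qed.

Definition eball_volume n : R := fine (lebesgue_rV n (@eball n 1)).

(** The crude factor [n] in place of [sqrt n] suffices: [n b^2 <= (n b)^2]. *)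
Lemma cube_sub_eball n (b r : R) : 0 <= r -> b * n%:R <= r -> cube 0 b `<=` @eball n r.
Proof.
move=> r0 br z zb; rewrite /eball /=.
have [n0|n0] := posnP n.
  rewrite /dotv big1 ?sqr_ge0// => i; have := ltn_ord i.
  by rewrite [X in (_ < X)%N]n0.
have b0 : 0 <= b by rewrite (le_trans (normr_ge0 _) (zb (Ordinal n0))).
rewrite (@le_trans _ _ (\sum_(i < n) b ^+ 2))//.
  apply: ler_sum => i _; rewrite -expr2 -real_normK ?num_real//.
  rewrite lerXn2r ?nnegrE//.
  by have := zb i; rewrite mxE subr0.
rewrite sumr_const card_ord -mulr_natr (@le_trans _ _ ((b * n%:R) ^+ 2))//.
  by rewrite exprMn ler_wpM2l ?sqr_ge0// expr2 ler_peMl// ler1n.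
by rewrite lerXn2r ?nnegrE ?mulr_ge0.
Qed.

Lemma eball_sub_cube n (r : R) : 0 <= r -> @eball n r `<=` cube 0 r.
Proof.
move=> r0 z; rewrite /eball /= => zr i; rewrite mxE subr0.
rewrite -(ler_pXn2r (n:=2)) ?nnegrE// real_normK ?num_real//.
exact: le_trans (sqr_le_dotv z i) zr.
Qed.

Lemma eball1_volumeE n : lebesgue_rV n (@eball n 1) = (eball_volume n)%:E.
Proof.
rewrite /eball_volume fineK// ge0_fin_numE//.
apply: (@le_lt_trans _ _ (lebesgue_rV n (cube 0 1))).
  apply: le_measure; rewrite ?inE; [exact: measurable_eball|exact: measurable_cube|].
  exact: eball_sub_cube.
by rewrite lebesgue_cube// ltry.
Qed.

Lemma eball_volume_gt0 n : 0 < eball_volume n.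
Proof.
rewrite -lte_fin -eball1_volumeE.
pose b : R := (n.+1%:R)^-1.
apply: (@lt_le_trans _ _ (lebesgue_rV n (cube 0 b))).
  by rewrite lebesgue_cube ?invr_ge0// lte_fin exprn_gt0// mulr_gt0// invr_gt0 ltr0n.
apply: le_measure; rewrite ?inE; [exact: measurable_cube|exact: measurable_eball|].
by apply: cube_sub_eball => //; rewrite mulrC ler_pdivrMr ?ltr0n// mul1r ler_nat.
Qed.

Lemma lebesgue_eball n (r : R) : 0 < r ->
  lebesgue_rV n (@eball n r) = (r ^+ n * eball_volume n)%:E.
Proof.
move=> r0; rewrite EFinM -eball1_volumeE -lebesgue_rV_scale//; last exact: measurable_eball.
congr (lebesgue_rV n _); apply/seteqP; split=> z; rewrite /eball /=.
all: rewrite (_ : dotv (r^-1 *: z) _ = (r ^+ 2)^-1 * dotv z z);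
  [|by rewrite /dotv mulr_sumr; apply: eq_bigr => i _; rewrite !mxE; field; rewrite gt_eqF].
all: by rewrite mulrC ler_pdivrMr ?exprn_gt0// expr1n mul1r.
Qed.

Lemma dotv_mx n (z w : 'rV[R]_n) : dotv z w = (z *m w^T) 0 0.
Proof. by rewrite mxE; apply: eq_bigr => i _; rewrite mxE. Qed.

Lemma dotv_delta n (z : 'rV[R]_n.+1) : dotv z (delta_mx 0 0) = z 0 0.
Proof.
rewrite /dotv (bigD1 ord0)//= !mxE eqxx mulr1 big1 ?addr0// => i i0.
by rewrite mxE (negPf i0) andbF mulr0.
Qed.

(** Whichever orthonormal frame [get] selects, [z -> z Q] is an isometry onto the vectors with first
    coordinate 0, so a ball pulls back to a ball. *)
Lemma hyperplane_volume_eball m (x : 'rV[R]_m.+1) (A : set 'rV[R]_m.+1) (r : R) :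
  (forall w : 'rV[R]_m.+1, w 0 0 = 0 -> A (x + w) <-> dotv w w <= r ^+ 2) ->
  hyperplane_volume x (delta_mx 0 0) A = lebesgue_rV m (@eball m r).
Proof.
move=> Aw; rewrite /hyperplane_volume.
set Q := get _; have [QQ Qu] : @orthonormal_frame R m.+1 (delta_mx 0 0) Q.
  apply: (@getPex _ [set Q | orthonormal_frame (delta_mx 0 0) Q]).
  (* The remaining standard basis vectors form a frame, so [get] does not return a default value. *)
  exists (\matrix_(i, j) (j == lift ord0 i)%:R); split.
    apply/matrixP => i j; rewrite !mxE (bigD1 (lift ord0 i))//= !mxE eqxx mul1r.
    rewrite big1 ?addr0; first by rewrite (inj_eq lift_inj).
    by move=> k ki; rewrite !mxE (negPf ki) mul0r.
  by move=> i; rewrite dotv_delta !mxE.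
congr (lebesgue_rV m _); apply/seteqP; split=> z; rewrite /eball /=.
all: have w0 : (z *m Q) 0 0 = 0 by (rewrite mxE big1// => i _;
  have := Qu i; rewrite dotv_delta mxE => ->; rewrite mulr0).
all: have zz : dotv (z *m Q) (z *m Q) = dotv z z
  by rewrite !dotv_mx trmx_mul mulmxA -(mulmxA z) QQ mulmx1.
- by move=> /(Aw _ w0); rewrite zz.
- by rewrite -zz => /(Aw _ w0).
Qed.

End EuclideanBall.

(** * The truncated cone *)

Section EuclideanNorm.
Context {R : realType} {n : nat}.
Implicit Types x y z w : 'rV[R]_n.

Lemma enorm_ge0 z : 0 <= enorm z. Proof. exact: sqrtr_ge0. Qed.

Lemma sqr_enorm z : enorm z ^+ 2 = dotv z z.
Proof. by rewrite sqr_sqrtr// dotv_ge0. Qed.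

Lemma enorm_le z (r : R) : 0 <= r -> (enorm z <= r) = (dotv z z <= r ^+ 2).
Proof. by move=> r0; rewrite -sqr_enorm ler_pXn2r// nnegrE// enorm_ge0. Qed.

Lemma dotvC z w : dotv z w = dotv w z.
Proof. by apply: eq_bigr => i _; rewrite mulrC. Qed.

Lemma dotvDl x y z : dotv (x + y) z = dotv x z + dotv y z.
Proof. by rewrite -big_split/=; apply: eq_bigr => i _; rewrite mxE mulrDl. Qed.

Lemma dotvZl (a : R) x z : dotv (a *: x) z = a * dotv x z.
Proof. by rewrite mulr_sumr; apply: eq_bigr => i _; rewrite mxE mulrA. Qed.

Lemma dotv_lincomb (a b : R) z w :
  dotv (a *: z + b *: w) (a *: z + b *: w) =
  a ^+ 2 * dotv z z + 2 * (a * b) * dotv z w + b ^+ 2 * dotv w w.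
Proof.
rewrite dotvDl !dotvZl ![dotv _ (_ + _)]dotvC !dotvDl !dotvZl (dotvC w z).
by ring.
Qed.

Lemma enorm0_eq0 z : enorm z = 0 -> z = 0.
Proof.
move=> z0; apply/rowP => i; rewrite mxE; apply/eqP; rewrite -sqrf_eq0 eq_le sqr_ge0 andbT.
by rewrite (le_trans (sqr_le_dotv z i))// -sqr_enorm z0 expr0n.
Qed.

Lemma enormN z : enorm (- z) = enorm z.
Proof. by rewrite /enorm -scaleN1r dotvZl dotvC dotvZl mulrA mulrNN !mul1r. Qed.

(** Cauchy-Schwarz, from expanding the square of the norm of [|w| z - |z| w]. *)
Lemma dotv_le_enorm z w : dotv z w <= enorm z * enorm w.
Proof.
have [z0|zn0] := eqVneq (enorm z) 0.
  by rewrite z0 mul0r (enorm0_eq0 z0) /dotv big1// => i _; rewrite mxE mul0r.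
have [w0|wn0] := eqVneq (enorm w) 0.
  by rewrite w0 mulr0 (enorm0_eq0 w0) /dotv big1// => i _; rewrite mxE mulr0.
have z0 : 0 < enorm z by rewrite lt_neqAle eq_sym zn0 enorm_ge0.
have w0 : 0 < enorm w by rewrite lt_neqAle eq_sym wn0 enorm_ge0.
have := dotv_ge0 (enorm w *: z + (- enorm z) *: w).
rewrite dotv_lincomb -!sqr_enorm => h.
have zw0 : 0 < 2 * (enorm z * enorm w) by rewrite !mulr_gt0.
rewrite -(ler_pM2l zw0) -subr_ge0; apply: (le_trans h).
by rewrite le_eqVlt; apply/orP; left; apply/eqP; ring.
Qed.

Lemma enorm_lincomb_le (a b : R) z w : 0 <= a -> 0 <= b ->
  enorm (a *: z + b *: w) <= a * enorm z + b * enorm w.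
Proof.
move=> a0 b0; rewrite enorm_le; last by rewrite addr_ge0// mulr_ge0// enorm_ge0.
rewrite dotv_lincomb -!sqr_enorm.
have -> : (a * enorm z + b * enorm w) ^+ 2 =
  a ^+ 2 * enorm z ^+ 2 + 2 * (a * b) * (enorm z * enorm w) + b ^+ 2 * enorm w ^+ 2 by ring.
by rewrite lerD2r lerD2l ler_wpM2l ?mulr_ge0// dotv_le_enorm.
Qed.

Lemma continuous_enorm (V : topologicalType) (f : V -> 'rV[R]_n) :
  (forall i, continuous (fun v => f v 0 i)) -> continuous (fun v => enorm (f v)).
Proof.
move=> cf v; apply: (continuous_comp (f := fun v => dotv (f v) (f v))); last exact: sqrt_continuous.
move: v; apply: continuous_big => [|i _]; first exact: add_continuous.
by move=> v; apply: continuousM; exact: cf.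
Qed.

End EuclideanNorm.

(** * Geometry of the truncated cone *)

Section ConeBody.
Context {R : realType} {m : nat} (delta r : R).
Hypotheses (delta0 : 0 < delta) (delta_r : 2 * delta <= r) (r_lt : r < 4^-1).

Definition tail (y : 'rV[R]_m.+1) : 'rV[R]_m := \row_j y 0 (lift ord0 j).

Lemma tail_rV_cons (t : R) (z : 'rV[R]_m) : tail (rV_cons (t, z)) = z.
Proof. by apply/rowP => i; rewrite !mxE liftK. Qed.

Lemma rV_cons00 (t : R) (z : 'rV[R]_m) : rV_cons (t, z) 0 0 = t.
Proof. by rewrite mxE unlift_none. Qed.

Lemma tailD x y : tail (x + y) = tail x + tail y.
Proof. by apply/rowP => i; rewrite !mxE. Qed.

Lemma tailZ (a : R) x : tail (a *: x) = a *: tail x.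
Proof. by apply/rowP => i; rewrite !mxE. Qed.

Lemma tail_delta : tail (delta_mx 0 0) = 0.
Proof. by apply/rowP => i; rewrite !mxE. Qed.

Lemma dotv_tail (y : 'rV[R]_m.+1) : dotv y y = y 0 0 ^+ 2 + dotv (tail y) (tail y).
Proof.
rewrite {1}/dotv big_ord_recl expr2; congr (_ + _).
by apply: eq_bigr => i _; rewrite !mxE.
Qed.

Lemma enorm_tail_le (y : 'rV[R]_m.+1) : enorm (tail y) <= enorm y.
Proof. by rewrite enorm_le ?enorm_ge0// sqr_enorm [leRHS]dotv_tail lerDr sqr_ge0. Qed.

(* A truncated cone with apex half-width r/2; at depth delta below its top
   face its section is a ball of radius exactly r, and by AM-GM its radius at
   depth s is at least r * sqrt (s / delta). *)
Definition cone_radius (t : R) := r / 2 * (1 + (2 - t) / delta).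

(** The top face is at height 2. The bounds on height and width leave room for the unit ball and
    keep the body in the ball of radius 3, as [2^2 + 1^2 <= 9]. *)
Definition cone_body : set 'rV[R]_m.+1 :=
  [set y : 'rV[R]_m.+1 | [/\ -1 <= y 0 0, y 0 0 <= 2, enorm (tail y) <= 1
             & enorm (tail y) <= cone_radius (y 0 0)]].

Definition cone_point : 'rV[R]_m.+1 := (2 - delta) *: delta_mx 0 0.

Lemma r_gt0 : 0 < r.
Proof. by have := delta0; have := delta_r; lra. Qed.

Lemma cone_radius_ge t : t <= 2 -> r / 2 <= cone_radius t.
Proof.
move=> t2; rewrite /cone_radius ler_peMr ?divr_ge0 ?(ltW r_gt0)//.
by rewrite lerDl divr_ge0 ?(ltW delta0)// subr_ge0.
Qed.

(** The radius grows with depth at rate [r / (2 delta)], which is at least 1. On the unit ball the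
    depth is at least 1, so the cone condition holds there. *)
Lemma cone_radius_ge_depth t : t <= 2 -> 2 - t <= cone_radius t.
Proof.
move=> t2; rewrite /cone_radius mulrDr mulr1.
apply: (@le_trans _ _ (r / 2 * ((2 - t) / delta))); last first.
  by rewrite lerDr divr_ge0 ?(ltW r_gt0).
have -> : r / 2 * ((2 - t) / delta) = (r / (2 * delta)) * (2 - t).
  by field; rewrite gt_eqF.
by rewrite ler_peMl ?subr_ge0// ler_pdivlMr ?mul1r ?mulr_gt0.
Qed.

Lemma convex_cone_body : convex_set (cone_body : set (convex_lmodType 'rV[R]_m.+1)).
Proof.
move=> x y l; rewrite !inE => -[x1 x2 x3 x4] [y1 y2 y3 y4].
have l0 : 0 <= l%:num by [].
have l1 : 0 <= 1 - l%:num by rewrite subr_ge0.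
have ll : l%:num + (1 - l%:num) = 1 by rewrite addrC subrK.
set a := l%:num in l0 ll *; set b := 1 - l%:num in l1 ll *.
change (cone_body (a *: (x : 'rV[R]_m.+1) + b *: (y : 'rV[R]_m.+1))).
have E0 : (a *: (x : 'rV[R]_m.+1) + b *: (y : 'rV[R]_m.+1)) 0 0 = a * x 0 0 + b * y 0 0.
  by rewrite !mxE.
have El := enorm_lincomb_le (tail x) (tail y) l0 l1.
rewrite /cone_body /= E0 tailD !tailZ; split.
- have h1 : a * (-1) <= a * x 0 0 by apply: ler_wpM2l.
  have h2 : b * (-1) <= b * y 0 0 by apply: ler_wpM2l.
  lra.
- have h1 : a * x 0 0 <= a * 2 by apply: ler_wpM2l.
  have h2 : b * y 0 0 <= b * 2 by apply: ler_wpM2l.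
  lra.
- apply: (le_trans El).
  have h1 : a * enorm (tail x) <= a * 1 by apply: ler_wpM2l.
  have h2 : b * enorm (tail y) <= b * 1 by apply: ler_wpM2l.
  lra.
- apply: (le_trans El).
  (* The radius is an affine function of the height. *)
  have -> : cone_radius (a * x 0 0 + b * y 0 0) =
            a * cone_radius (x 0 0) + b * cone_radius (y 0 0).
    have -> : b = 1 - a by lra.
    by rewrite /cone_radius; field; rewrite gt_eqF.
  by rewrite lerD// ler_wpM2l.
Qed.

Lemma unit_ball_sub_cone_body : unit_ball `<=` cone_body.
Proof.
move=> y; rewrite /unit_ball /= => y1.
have t1 : enorm (tail y) <= 1 by rewrite (le_trans (enorm_tail_le y)).
move: y1; rewrite enorm_le// expr1n dotv_tail -sqr_enorm => y1.
have t0 := enorm_ge0 (tail y).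
have [y0l y0u] : -1 <= y 0 0 /\ y 0 0 <= 1 by split; nra.
split=> //; first by lra.
rewrite (le_trans _ (cone_radius_ge_depth _))//; last by lra.
by nra.
Qed.

Lemma cone_body_sub_ball3 : cone_body `<=` [set 3 *: y | y in unit_ball].
Proof.
move=> y [y1 y2 y3 _]; exists (3^-1 *: y); last first.
  by rewrite scalerA mulfV ?scale1r// pnatr_eq0.
rewrite /unit_ball /= enorm_le// expr1n dotvZl dotvC dotvZl dotv_tail -sqr_enorm.
have := enorm_ge0 (tail y); set e := enorm _ in y3 * => e0.
have : e ^+ 2 <= 1 by nra.
have : y 0 0 ^+ 2 <= 4 by nra.
by move=> h1 h2; lra.
Qed.

Lemma cone_point00 : cone_point 0 0 = 2 - delta.
Proof. by rewrite !mxE eqxx mulr1. Qed.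

Lemma tail_cone_point : tail cone_point = 0.
Proof. by rewrite tailZ tail_delta scaler0. Qed.

(** Heights stay at most 2, and the distance to the axis is at most [delta <= r / 2], the radius of
    the top face. *)
Lemma ball_sub_cone_body y : enorm (y - cone_point) < delta -> cone_body y.
Proof.
set w := y - _ => /ltW wd.
have -> : y = cone_point + w by rewrite /w addrC subrK.
have tw : enorm (tail w) <= delta by rewrite (le_trans (enorm_tail_le w)).
have [w0l w0u] : - delta <= w 0 0 /\ w 0 0 <= delta.
  move: wd; rewrite enorm_le ?(ltW delta0)// => wd.
  have := sqr_le_dotv w 0 => /le_trans/(_ wd) h.
  by have := delta0; split; nra.
have d8 : delta < 8^-1 by have := delta_r; have := r_lt; lra.
have Y0 : (cone_point + w) 0 0 = 2 - delta + w 0 0 by rewrite mxE cone_point00.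
have tY : tail (cone_point + w) = tail w by rewrite tailD tail_cone_point add0r.
split; rewrite ?Y0 ?tY; [by lra|by lra|by lra|].
rewrite (le_trans tw)// (le_trans _ (cone_radius_ge _))//; last by lra.
by have := delta_r; lra.
Qed.

Lemma cone_body_cone_point : cone_body cone_point.
Proof.
apply: ball_sub_cone_body; rewrite subrr /enorm /dotv big1 ?sqrtr0// => i _.
by rewrite mxE mul0r.
Qed.

Lemma continuous_enorm_tail : continuous (fun y : 'rV[R]_m.+1 => enorm (tail y)).
Proof.
apply: continuous_enorm => i.
rewrite (_ : (fun y => _) = (fun y : 'rV[R]_m.+1 => y 0 (lift ord0 i))).
  exact: coord_continuous.
by apply/funext => y; rewrite mxE.
Qed.

Lemma closed_cone_body : closed cone_body.
Proof.
have cle (f : 'rV[R]_m.+1 -> R) (a : R) : continuous f -> closed [set y | f y <= a].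
  by move=> /continuous_closedP/(_ _ (@closed_le R a)).
have c0 : continuous (fun y : 'rV[R]_m.+1 => y 0 0) by exact: coord_continuous.
rewrite (_ : cone_body = [set y : 'rV[R]_m.+1 | - y 0 0 <= 1]
   `&` [set y : 'rV[R]_m.+1 | y 0 0 <= 2]
   `&` [set y | enorm (tail y) <= 1]
   `&` [set y | enorm (tail y) - cone_radius (y 0 0) <= 0]).
  apply: closedI; [apply: closedI; [apply: closedI|]|]; apply: cle => //.
  - by move=> y; apply: continuousN; exact: c0.
  - exact: continuous_enorm_tail.
  - have ccr : continuous cone_radius.
      move=> t; apply: cvgM; first exact: cvg_cst.
      apply: cvgD; first exact: cvg_cst.
      by apply: cvgM; [apply: cvgB; [exact: cvg_cst|exact: cvg_id]|exact: cvg_cst].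
    have cc : continuous (fun y : 'rV[R]_m.+1 => cone_radius (y 0 0)).
      by move=> y; exact: continuous_comp (c0 y) (ccr _).
    by move=> y; exact: (continuousB (@continuous_enorm_tail y) (cc y)).
apply/seteqP; split=> y /=.
  by move=> [h1 h2 h3 h4]; split; [split; [split; lra|]|rewrite subr_le0].
by move=> [[[h1 h2] h3] h4]; split=> //; [lra|rewrite -subr_le0].
Qed.

Lemma cone_body_sub_cube : cone_body `<=` cube 0 2.
Proof.
move=> y [y1 y2 y3 _] i; rewrite mxE subr0.
case: (unliftP ord0 i) => [j ->|->]; last by rewrite ler_norml; apply/andP; split; lra.
have := sqr_le_dotv (tail y) j; rewrite -sqr_enorm mxE.
have := enorm_ge0 (tail y) => h1 h2.
by rewrite ler_norml; apply/andP; split; nra.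
Qed.

Lemma cone_body_interior0 : cone_body° 0.
Proof.
apply/nbhs_ballP; exists (m.+2%:R)^-1; first by rewrite /= invr_gt0 ltr0n.
move=> y [_ /(_ 0) yb]; apply: unit_ball_sub_cone_body.
rewrite /unit_ball /= enorm_le//; apply: (@cube_sub_eball _ _ (m.+2%:R)^-1) => //.
  by rewrite mulrC ler_pdivrMr ?ltr0n// mul1r ler_nat.
move=> i; have := yb i; rewrite /ball /= => h.
by rewrite distrC ltW.
Qed.

Lemma convex_body_cone_body : convex_body cone_body.
Proof.
split; first exact: convex_cone_body.
- apply: bounded_closed_compact; last exact: closed_cone_body.
  exists 2; split; first exact: num_real.
  move=> M M2 y /cone_body_sub_cube yc /=.
  rewrite [leLHS]mx_normrE; apply: bigmax_le; first by lra.
  move=> [i j] _ /=; rewrite ord1; have := yc j; rewrite mxE subr0 => h.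
  by rewrite (le_trans h)// ltW.
- by exists 0; exact: cone_body_interior0.
Qed.

Lemma measurable_cone_body : measurable cone_body.
Proof.
have mt : measurable_fun [set: 'rV[R]_m.+1] (fun y : 'rV[R]_m.+1 => enorm (tail y)).
  apply: (@measurableT_comp _ _ _ _ _ _ (@Num.sqrt R) _
    (fun y : 'rV[R]_m.+1 => dotv (tail y) (tail y))).
    by apply: continuous_measurable_fun; exact: sqrt_continuous.
  apply: (measurableT_comp (@measurable_dotv R m) (_ : measurable_fun [set: 'rV[R]_m.+1] tail)).
  rewrite (_ : tail = snd \o @rV_uncons R m)//.
  by apply: measurableT_comp => //; exact: measurable_rV_uncons.
have m0 : measurable_fun [set: 'rV[R]_m.+1] (fun y : 'rV[R]_m.+1 => y 0 0).
  exact: (measurable_coord ord0).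
have mle (f : 'rV[R]_m.+1 -> R) (a : R) : measurable_fun [set: 'rV[R]_m.+1] f ->
    measurable [set y | f y <= a].
  move=> mf; have := mf measurableT _ (measurable_itv `]-oo, a]).
  by rewrite setTI.
rewrite (_ : cone_body = [set y : 'rV[R]_m.+1 | - y 0 0 <= 1]
   `&` [set y : 'rV[R]_m.+1 | y 0 0 <= 2]
   `&` [set y | enorm (tail y) <= 1]
   `&` [set y | enorm (tail y) - cone_radius (y 0 0) <= 0]).
  apply: measurableI; [apply: measurableI; [apply: measurableI|]|]; apply: mle => //.
  - exact: measurableT_comp.
  - apply: measurable_funB => //; apply: measurable_funM => //.
    by apply: measurable_funD => //; apply: measurable_funM => //; exact: measurable_funB.
apply/seteqP; split=> y /=.
  by move=> [h1 h2 h3 h4]; split; [split; [split; lra|]|rewrite subr_le0].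
by move=> [[[h1 h2] h3] h4]; split=> //; [lra|rewrite -subr_le0].
Qed.

Lemma cone_pointD (t : R) : cone_point + t *: delta_mx 0 0 = (2 - delta + t) *: delta_mx 0 0.
Proof. by rewrite -scalerDl. Qed.

Lemma cone_body_top t : cone_body (cone_point + t *: delta_mx 0 0) -> t <= delta.
Proof. by rewrite cone_pointD => -[_ + _ _]; rewrite !mxE eqxx mulr1; lra. Qed.

Lemma cone_body_supporting :
  supporting_hyperplane cone_body (cone_point + delta *: delta_mx 0 0) (delta_mx 0 0).
Proof.
split=> [|y [_ y2 _ _]]; last first.
  by rewrite dotv_delta !mxE eqxx !mulr1; lra.
rewrite cone_pointD subrK.
have e0 : enorm (tail (2 *: delta_mx 0 0)) = 0.
  by rewrite tailZ tail_delta scaler0 /enorm /dotv big1 ?sqrtr0// => i _; rewrite mxE mul0r.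
have t2 : (2 *: delta_mx 0 0 : 'rV[R]_m.+1) 0 0 = 2 by rewrite !mxE eqxx mulr1.
split; rewrite ?e0 ?t2 ?lexx//; first by lra.
rewrite (le_trans _ (cone_radius_ge (lexx _)))// divr_ge0// ltW//.
exact: r_gt0.
Qed.

Lemma cone_body_boundary : boundary cone_body (cone_point + delta *: delta_mx 0 0).
Proof.
split; first by apply: subset_closure; exact: cone_body_supporting.1.
(* A neighbourhood inside the body would contain a point [e / 2] above the top face. *)
move=> /nbhs_ballP [e /= e0 /(_ (cone_point + (delta + e / 2) *: delta_mx 0 0))].
move=> h; suff : delta + e / 2 <= delta by lra.
apply: cone_body_top; apply: h; split=> // i j.
rewrite /ball /= !mxE !ord1 eqxx /=.
set k : R := _%:R.
have k01 : 0 <= k <= 1 by rewrite /k; case: (j == 0); rewrite ?lexx ?ler01.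
rewrite ltr_norml; apply/andP; split; nra.
Qed.

(** The open ball of radius [delta] lies in the interior, so no boundary point is closer; the centre
    of the top face is at distance exactly [delta]. *)
Lemma dist_cone_body : dist cone_point (boundary cone_body) = delta.
Proof.
have enorm_delta : enorm (delta *: delta_mx 0 0 : 'rV[R]_m.+1) = delta.
  by rewrite /enorm dotvZl dotvC dotvZl dotv_delta mxE eqxx mulr1 -expr2 sqrtr_sqr gtr0_norm.
have lb : lbound [set enorm (cone_point - y) | y in boundary cone_body] delta.
  move=> _ [y [_ yint] <-]; rewrite leNgt; apply/negP => yd; apply: yint.
  have opB : open [set z | enorm (z - cone_point) < delta].
    have cB : continuous (fun z : 'rV[R]_m.+1 => enorm (z - cone_point)).
      apply: continuous_enorm => i z.
      rewrite (_ : (fun v => _) = (fun v : 'rV[R]_m.+1 => v 0 i - cone_point 0 i)); last first.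
        by apply/funext => v; rewrite !mxE.
      exact: (continuousB (@coord_continuous R 1 m.+1 0 i z)
        (@cst_continuous _ _ (cone_point 0 i) z)).
    by move/continuousP: cB => /(_ _ (@open_lt R delta)).
  have : [set z | enorm (z - cone_point) < delta] `<=` cone_body.
    by move=> z; exact: ball_sub_cone_body.
  by rewrite (open_subsetE _ opB); apply; rewrite /= -enormN opprB.
apply/eqP; rewrite eq_le; apply/andP; split.
  apply: ge_inf; first by exists delta.
  exists (cone_point + delta *: delta_mx 0 0); first exact: cone_body_boundary.
  by rewrite opprD addNKr enormN.
apply: lb_le_inf => //; exists (enorm (cone_point - (cone_point + delta *: delta_mx 0 0))).
by exists (cone_point + delta *: delta_mx 0 0) => //; exact: cone_body_boundary.
Qed.

(** At height [2 - delta] the cone radius is [r], and [r < 1/4] makes the width bound 1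
    automatic. *)
Lemma cone_body_section (w : 'rV[R]_m.+1) : w 0 0 = 0 ->
  (cone_body (cone_point + w) /\ dotv (cone_point + w - cone_point) (delta_mx 0 0) = 0)
  <-> dotv w w <= r ^+ 2.
Proof.
move=> w0; have r0 := r_gt0.
have -> : cone_point + w - cone_point = w by rewrite addrC addKr.
rewrite dotv_delta.
have y0 : (cone_point + w) 0 0 = 2 - delta by rewrite mxE cone_point00 w0 addr0.
have ty : tail (cone_point + w) = tail w by rewrite tailD tail_cone_point add0r.
have cr : cone_radius (2 - delta) = r by rewrite /cone_radius; field; rewrite gt_eqF.
have -> : (dotv w w <= r ^+ 2) = (enorm (tail w) <= r).
  by rewrite enorm_le ?(ltW r0)// [in LHS]dotv_tail w0 expr0n add0r.
split=> [[[_ _ _]]|wr]; first by rewrite y0 ty cr.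
have := delta_r; have := r_lt; have := delta0 => h1 h2 h3.
by split=> //; split; rewrite ?y0 ?ty ?cr//; lra.
Qed.

(** With [s = (2 - t) / delta], the chain is [|z|^2 <= a^2 (2 - t) <= r^2 s <= r^2 (1 + s)^2 / 4],
    the last step being AM-GM. The cube keeps [|z| <= a], hence [0 <= t <= 2]. *)
Lemma paraboloid_sub_cone_body (a t : R) (z : 'rV[R]_m) :
  0 < a -> a <= 1 -> a ^+ 2 * delta <= r ^+ 2 -> cube 0 (a / m.+1%:R) z ->
  2 - dotv z z / a ^+ 2 - 1 <= t -> t <= 2 - dotv z z / a ^+ 2 ->
  cone_body (rV_cons (t, z)).
Proof.
move=> a0 a1 ar zc t1 t2.
have za : dotv z z <= a ^+ 2.
  apply: (@cube_sub_eball _ _ (a / m.+1%:R)) => //; first exact: ltW.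
  rewrite mulrAC ler_pdivrMr ?ltr0n//; apply: ler_wpM2l; first exact: ltW.
  by rewrite ler_nat.
have a20 : 0 < a ^+ 2 by rewrite exprn_gt0.
have q0 : 0 <= dotv z z / a ^+ 2 by rewrite divr_ge0 ?dotv_ge0// ltW.
have q1 : dotv z z / a ^+ 2 <= 1 by rewrite ler_pdivrMr// mul1r.
have zs : dotv z z <= a ^+ 2 * (2 - t) by rewrite mulrC -ler_pdivrMr//; lra.
have s0 : 0 <= 2 - t by lra.
split; rewrite ?rV_cons00 ?tail_rV_cons; [by lra|by lra| |].
  by rewrite enorm_le// expr1n (le_trans za)// expr_le1// ltW.
have c0 : 0 <= cone_radius t.
  by rewrite (le_trans _ (cone_radius_ge _))// ?divr_ge0 ?(ltW r_gt0)//; lra.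
rewrite enorm_le// (le_trans zs)//.
apply: (@le_trans _ _ (r ^+ 2 * ((2 - t) / delta))).
  have -> : a ^+ 2 * (2 - t) = a ^+ 2 * delta * ((2 - t) / delta).
    by field; rewrite gt_eqF.
  by apply: ler_wpM2r => //; rewrite divr_ge0// ltW.
rewrite /cone_radius exprMn; set s := (2 - t) / delta.
have -> : (r / 2) ^+ 2 * (1 + s) ^+ 2 = r ^+ 2 * s + r ^+ 2 * ((1 - s) / 2) ^+ 2 by field.
by rewrite lerDl mulr_ge0// sqr_ge0.
Qed.

End ConeBody.

(** * Point evaluation on the truncated cone *)

Section ConeChristoffel.
Context {R : realType} {m : nat} (delta r a : R).
Hypotheses (delta0 : 0 < delta) (delta_r : 2 * delta <= r) (r_lt : r < 4^-1).
Hypotheses (a0 : 0 < a) (a1 : a <= 1) (ar : a ^+ 2 * delta <= r ^+ 2).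

Let top (z : 'rV[R]_m) : R := 2 - dotv z z / a ^+ 2.
Let D := @cone_body R m delta r.
Let b : R := a / m.+1%:R.

Let b0 : 0 < b. Proof. by rewrite divr_gt0// ltr0n. Qed.

Let D_top t z : cube 0 b z -> top z - 1 <= t -> t <= top z -> D (rV_cons (t, z)).
Proof. by move=> zb; exact: paraboloid_sub_cone_body zb. Qed.

Variables (n : nat) (p : mpoly m.+1 R).
Hypotheses (n0 : (0 < n)%N) (pn : polys_of_degree_le n p).

(** The polynomial on the paraboloid lowered by [delta], which the shear makes flat; [G 0] is its
    value at the cone point. *)
Let G (z : 'rV[R]_m) : R := peval p (rV_cons (top z - delta, z)).

(** Since [top] is quadratic, a line in [z] lifts to a curve with coordinates of degree at most
    2. *)
Let G_lines : poly_along_lines (2 * n) G.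
Proof.
move=> z w.
pose l (j : 'I_m) : {poly R} := (z 0 j)%:P + w 0 j *: 'X.
pose q (i : 'I_m.+1) : {poly R} := if unlift ord0 i is Some j then l j
  else (2 - delta)%:P - (a ^- 2) *: \sum_j l j * l j.
have sl j : (size (l j) <= 2)%N.
  rewrite (leq_trans (size_polyD _ _))// geq_max (leq_trans (size_polyC_leq1 _))//=.
  by rewrite (leq_trans (size_scale_leq _ _))// size_polyX.
have sq i : (size (q i) <= 3)%N.
  rewrite /q; case: unlift => [j|]; first exact: leq_trans (sl j) _.
  rewrite (leq_trans (size_polyD _ _))// geq_max (leq_trans (size_polyC_leq1 _))//=.
  rewrite size_polyN (leq_trans (size_scale_leq _ _))//.
  rewrite (leq_trans (size_sum _ _ _))//; apply/bigmax_leqP => j _.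
  exact: size_polyM_le (sl j) (sl j).
have [P sP PE] := peval_curve pn sq; exists P => // t; rewrite -PE /G.
have lt j : (l j).[t] = (z + t *: w) 0 j by rewrite /l !hornerE !mxE [t * _]mulrC.
congr peval; apply/rowP => i; rewrite !mxE /q /=; case: unlift => [j|] /=; first by rewrite lt !mxE.
rewrite !hornerE horner_sum /top /dotv.
under [in RHS]eq_bigr do rewrite hornerM lt.
by ring.
Qed.

Let mG : measurable_fun [set: 'rV[R]_m] G.
Proof.
apply: (measurableT_comp (measurable_peval p)).
apply: (measurableT_comp (@measurable_rV_cons R m)).
apply/measurable_fun_pairP; split; last exact: measurable_id.
apply: measurable_funB => //; apply: measurable_funB => //.
by apply: measurable_funM => //; exact: measurable_dotv.
Qed.

Let slice (z : 'rV[R]_m) : exists2 P : {poly R}, (size P <= n.+1)%N &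
  forall t, peval p (rV_cons (t, z)) = P.[t].
Proof.
pose q (i : 'I_m.+1) : {poly R} := if unlift ord0 i is Some j then (z 0 j)%:P else 'X.
have sq i : (size (q i) <= 2)%N.
  rewrite /q; case: unlift => [j|]; last by rewrite size_polyX.
  exact: leq_trans (size_polyC_leq1 _) _.
have [P sP PE] := peval_curve pn sq; exists P; first by rewrite mul1n in sP.
move=> t; rewrite -PE; congr peval; apply/rowP => i; rewrite !mxE /q.
by case: unlift => [j|] /=; rewrite !hornerE.
Qed.

(** The shear is carried out by Fubini with the height as inner variable: [ge_top_integral_sqr] on
    the unit segment below [top z] bounds [G(z)^2], and [ge_cube_integral_sqr] for [G] then treats
    the horizontal variables. *)
Lemma cone_sqr_le (sigma : R) : 0 < sigma -> sigma * n%:R ^- 2 < delta ->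
  peval p (cone_point delta) ^+ 2 <=
  8 * (1 + (Num.sqrt sigma)^-1) * n%:R / Num.sqrt delta *
  (24 * (2 * n)%:R / (a / m.+1%:R)) ^+ m * inner_product D p p.
Proof.
move=> s0 sd; rewrite -/b.
set K1 := 8 * _ * _ / _; set K2 := _ ^+ m.
have K10 : 0 <= K1 by rewrite !mulr_ge0 ?invr_ge0 ?sqrtr_ge0// addr_ge0// invr_ge0 sqrtr_ge0.
have K20 : 0 <= K2 by rewrite exprn_ge0// divr_ge0 ?(ltW b0)// mulr_ge0.
have mD : measurable D by exact: measurable_cone_body.
have D2 : D `<=` cube 0 2 by exact: cone_body_sub_cube.
rewrite -lee_fin (EFinM (K1 * K2)); rewrite -(integral_sqr_peval mD (ler0n R 2) D2 p).
pose F y := (((fun y => (peval p y ^+ 2)%:E) \_ D) y : \bar R).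
have mF : measurable_fun [set: 'rV[R]_m.+1] F.
  apply/(measurable_restrictT _ mD).
  by apply/measurable_EFinP; apply: measurable_funTS; apply: measurable_funX; exact: measurable_peval.
have F0 y : (0 <= F y)%E by apply: erestrict_ge0 => z _; rewrite lee_fin sqr_ge0.
rewrite integral_mkcond -/F ge0_integral_rV_cons2//.
pose H z := (\int[@lebesgue_measure R]_t F (rV_cons (t, z)))%E.
have mH : measurable_fun [set: 'rV[R]_m] H by exact: measurable_integral_rV_cons2.
have H0 z : (0 <= H z)%E by apply: integral_ge0 => t _; exact: F0.
have inner z : cube 0 b z -> ((G z ^+ 2)%:E <= K1%:E * H z)%E.
  move=> zb; have [P sP PE] := slice z.
  have d2 : delta <= 1 / 2 by have := delta_r; have := r_lt; lra.
  rewrite /G PE (le_trans (ge_top_integral_sqr (top z) sP n0 s0 delta0 d2 sd))//.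
  apply: lee_wpmul2l; first by rewrite lee_fin.
  have mFz : measurable_fun [set: measurableTypeR R] (fun t => F (rV_cons (t, z))).
    apply: (measurableT_comp mF); apply: (measurableT_comp (@measurable_rV_cons R m)).
    exact: measurable_pair2.
  rewrite (_ : (\int[_]_(x in _) _)%E =
    (\int[@lebesgue_measure R]_(t in `[(top z - 1)%R, top z]) F (rV_cons (t, z)))%E).
    exact: ge0_subset_integral.
  apply: eq_integral => t; rewrite inE /= in_itv/= => /andP[t1 t2].
  by rewrite /F /patch mem_set ?PE//; exact: D_top.
have N0 : (0 < 2 * n)%N by rewrite muln_gt0.
have -> : peval p (cone_point delta) = G 0.
  rewrite /G; congr peval; apply/rowP => i; rewrite !mxE /top /dotv.
  rewrite big1 ?mul0r ?subr0; last by move=> j _; rewrite mxE mul0r.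
  case: unliftP => [j|] -> /=; first by rewrite mxE mulr0.
  by rewrite mulr1.
apply: (le_trans (ge_cube_integral_sqr 0 N0 b0 G_lines mG)).
rewrite -/K2 [K1 * K2]mulrC (EFinM K2) -muleA; apply: lee_wpmul2l; first by rewrite lee_fin.
apply: (@le_trans _ _ (\int[lebesgue_rV m]_(z in cube 0 b) (K1%:E * H z))%E).
  apply: ge0_le_integral => //.
  - exact: measurable_cube.
  - by move=> z _; rewrite lee_fin sqr_ge0.
  - by apply/measurable_EFinP; apply: measurable_funTS; exact: measurable_funX.
  - by apply: measurable_funTS; exact: measurable_funeM.
rewrite ge0_integralZl_EFin//; last 2 first.
- exact: measurable_cube.
- exact: measurable_funTS.
apply: lee_wpmul2l; first by rewrite lee_fin.
apply: ge0_subset_integral => //; exact: measurable_cube.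
Qed.

End ConeChristoffel.

(** * Powers of delta and the horizontal semi-axis *)

Section Constants.
Context {R : realType}.

(** The exponents add up: [1 - (m + 1) / 2 + m / 2 = 1 / 2]. *)
Lemma powR_half_split (delta : R) (m : nat) : 0 < delta ->
  delta `^ (1 - m.+1%:R / 2) * Num.sqrt delta ^+ m = Num.sqrt delta.
Proof.
move=> d0; have dn0 : delta != 0 by rewrite gt_eqF.
rewrite -powR_mulrn ?sqrtr_ge0// -powR12_sqrt ?(ltW d0)// -powRrM.
rewrite -powRD; last by rewrite dn0 implybT.
by congr (_ `^ _); rewrite -natr1; field.
Qed.

Lemma exists_pos_root (m : nat) (v V : R) : (0 < m)%N -> 0 < v -> 0 < V ->
  exists2 r, 0 < r & r ^+ m * V = v.
Proof.
move=> m0 v0 V0; exists ((v / V) `^ (m%:R^-1)); first by rewrite powR_gt0// divr_gt0.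
rewrite -powR_mulrn ?powR_ge0// -powRrM mulVf ?pnatr_eq0 -?lt0n// powRr1 ?divr_ge0 ?ltW//.
by rewrite divfK// gt_eqF.
Qed.

(* min 1 (r / sqrt delta) is the horizontal semi-axis a of the inscribed
   paraboloid. *)
Lemma min_le_semiaxis (m : nat) (delta r V : R) : 0 < delta -> 0 < r -> 0 < V ->
  Num.min 1 V^-1 * Num.min (Num.sqrt delta) (delta `^ (1 - m.+1%:R / 2) * (r ^+ m * V)) <=
  Num.sqrt delta * Num.min 1 (r / Num.sqrt delta) ^+ m.
Proof.
move=> d0 r0 V0; set s := Num.sqrt delta; set k := delta `^ _.
have s0 : 0 < s by rewrite sqrtr_gt0.
have ks : k * s ^+ m = s by exact: powR_half_split.
have k0 : 0 <= k by exact: powR_ge0.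
have M0 : 0 <= Num.min s (k * (r ^+ m * V)).
  by rewrite le_min ltW//= !mulr_ge0 ?exprn_ge0 ?(ltW r0)// ltW.
have [h|h] := leP 1 (r / s).
  rewrite expr1n mulr1 (@le_trans _ _ (1 * Num.min s (k * (r ^+ m * V))))//.
    by apply: ler_wpM2r => //; rewrite ge_min lexx.
  by rewrite mul1r ge_min lexx.
(* Here the semi-axis is [r / s], and the second entry of each minimum gives equality with the right
   side. *)
rewrite (@le_trans _ _ (V^-1 * (k * (r ^+ m * V))))//.
  apply: ler_pM => //.
  - by rewrite le_min ler01 invr_ge0 ltW.
  - by rewrite ge_min lexx orbT.
  - by rewrite ge_min lexx orbT.
rewrite le_eqVlt; apply/orP; left; apply/eqP.
have sm0 : s ^+ m != 0 by rewrite expf_neq0// gt_eqF.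
have -> : V^-1 * (k * (r ^+ m * V)) = k * r ^+ m by field; rewrite gt_eqF.
by rewrite expr_div_n -[X in _ = X * _]ks mulrACA mulfV// mulr1.
Qed.

End Constants.

(** * Choice of the constants and of the cone *)

Theorem theorem1p16 (R : realType) (d : nat) (hd : (2 <= d)%N) :
  exists (beta1 beta2 : R) (c : R -> R),
    [/\ 0 < beta1, 0 < beta2, (forall sigma, 0 < sigma -> 0 < c sigma)
    & forall delta v : R, 0 < delta -> 0 < v ->
      beta1 * delta ^+ d.-1 < v -> v < beta2 ->
      exists (D : set 'rV[R]_d) (x : 'rV[R]_d),
      [/\ convex_body D, D x,
          unit_ball `<=` D /\ D `<=` [set 3 *: y | y in unit_ball],
          delta = dist x (boundary D)
          /\ (exists u : 'rV[R]_d,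
              [/\ enorm u = 1,
                  boundary D (x + delta *: u),
                  (forall t : R, D (x + t *: u) -> t <= dist x (boundary D)),
                  supporting_hyperplane D (x + delta *: u) u
                & hyperplane_volume x u [set y | D y /\ dotv (y - x) u = 0]
                  = v%:E])
        & forall (sigma : R) (n : nat), 0 < sigma -> (0 < n)%N ->
            sigma * n%:R ^- 2 < delta ->
            c sigma * n%:R ^- d
              * Num.min (Num.sqrt delta) (delta `^ (1 - d%:R / 2) * v)
            <= christoffel D n x]].
Proof.
case: d hd => [|m]//; rewrite ltnS => m0 /=.
pose V : R := eball_volume m; have V0 : 0 < V by exact: eball_volume_gt0.
(* The first factors come from the depth direction. Each horizontal direction gives 24 from the
   midpoint bound, 2 from the doubled degree and [m + 1] from the half-side [a / (m + 1)]. *)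
pose C (sigma : R) := 8 * (1 + (Num.sqrt sigma)^-1) * (48 * m.+1%:R) ^+ m.
have C0 sigma : 0 < C sigma.
  have s1 : 0 < 1 + (Num.sqrt sigma)^-1 by rewrite ltr_wpDr ?invr_ge0 ?sqrtr_ge0.
  by apply: mulr_gt0; [exact: mulr_gt0|rewrite exprn_gt0// mulr_gt0// ltr0n].
(* As [v = r^m V], the two bounds on [v] amount to [2 delta < r] and [r < 1/4]. *)
exists (V * 2 ^+ m), (V * 4^-1 ^+ m), (fun sigma => (C sigma)^-1 * Num.min 1 V^-1); split.
- by rewrite mulr_gt0 ?exprn_gt0.
- by rewrite mulr_gt0 ?exprn_gt0 ?invr_gt0.
- by move=> sigma _; rewrite mulr_gt0 ?invr_gt0// lt_min ltr01 invr_gt0.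
move=> delta v delta0 v0 v_gt v_lt.
have [r r0 rv] := exists_pos_root m0 v0 V0.
have delta_r : 2 * delta <= r.
  rewrite leNgt; apply/negP => h; move: v_gt; apply/negP; rewrite -leNgt -rv.
  rewrite -mulrA -exprMn mulrC ler_pM2l// lerXn2r ?nnegrE ?(ltW r0) ?(ltW h)//.
  by rewrite mulr_ge0// ltW.
have r_lt : r < 4^-1.
  rewrite ltNge; apply/negP => h; move: v_lt; apply/negP; rewrite -leNgt -rv.
  by rewrite [leRHS]mulrC ler_pM2l// lerXn2r ?nnegrE ?(ltW r0) ?invr_ge0.
have dist_delta := @dist_cone_body R m delta r delta0 delta_r r_lt.
exists (cone_body delta r), (cone_point delta); split.
- exact: convex_body_cone_body.
- exact: cone_body_cone_point.
- by split; [exact: unit_ball_sub_cone_body|exact: cone_body_sub_ball3].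
- split; first by rewrite dist_delta.
  exists (delta_mx 0 0); split.
  + by rewrite /enorm dotv_delta mxE eqxx sqrtr1.
  + exact: cone_body_boundary.
  + by move=> t; rewrite dist_delta; exact: cone_body_top.
  + exact: cone_body_supporting.
  + rewrite (@hyperplane_volume_eball _ _ _ _ r); last by move=> w; exact: cone_body_section.
    by rewrite lebesgue_eball// -/V rv.
move=> sigma n s0 n0 sd.
set s := Num.sqrt delta; have sqrt0 : 0 < s by rewrite sqrtr_gt0.
(* The largest semi-axis with [a <= 1] and [a^2 delta <= r^2]. *)
pose a := Num.min 1 (r / s).
have a0 : 0 < a by rewrite lt_min ltr01 divr_gt0.
have a1 : a <= 1 by rewrite ge_min lexx.
have ar : a ^+ 2 * delta <= r ^+ 2.
  rewrite -ler_pdivlMr// -[in leRHS](sqr_sqrtr (ltW delta0)) -expr_div_n.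
  rewrite lerXn2r ?nnegrE ?(ltW a0) ?divr_ge0 ?(ltW r0) ?(ltW sqrt0)//.
  by rewrite ge_min lexx orbT.
have n0' : 0 < n%:R :> R by rewrite ltr0n.
pose K := C sigma * n%:R ^+ m.+1 / (s * a ^+ m).
have K0 : 0 < K by rewrite divr_gt0 ?mulr_gt0 ?exprn_gt0.
have KE : K = 8 * (1 + (Num.sqrt sigma)^-1) * n%:R / s *
    (24 * (2 * n)%:R / (a / m.+1%:R)) ^+ m.
  have -> : 24 * (2 * n)%:R / (a / m.+1%:R) = 48 * m.+1%:R * n%:R / a.
    by rewrite natrM; field; rewrite gt_eqF//= pnatr_eq0.
  rewrite /K /C expr_div_n [(_ * n%:R) ^+ m]exprMn [n%:R ^+ m.+1]exprS.
  set u := (Num.sqrt sigma)^-1; set w := (48 * m.+1%:R) ^+ m.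
  have am0 : a ^+ m != 0 by rewrite expf_neq0// gt_eqF.
  by field; rewrite am0 gt_eqF.
apply: (@le_trans _ _ K^-1).
  rewrite -rv; have := min_le_semiaxis m delta0 r0 V0; rewrite -/s -/a.
  set mn := Num.min s _ => H.
  have -> : K^-1 = (C sigma)^-1 * n%:R ^- m.+1 * (s * a ^+ m).
    by rewrite /K invf_div mulrC invfM.
  have -> (e f g h : R) : e * f * g * h = e * g * (f * h) by ring.
  apply: ler_wpM2l => //.
  by rewrite mulr_ge0// invr_ge0 ?exprn_ge0// ltW.
(* Half-sides of cubes around and inside the body; the inner cube lies in the unit ball, as
   [(m + 1) / (m + 2) <= 1]. *)
apply: (@christoffel_ge _ _ _ 2 (m.+2%:R)^-1) => //.
- exact: measurable_cone_body.
- exact: cone_body_sub_cube.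
- by rewrite invf_le1 ?ltr0n// ler1n.
- move=> y yc; apply: (unit_ball_sub_cone_body delta0 delta_r).
  rewrite /unit_ball /= enorm_le//.
  apply: cube_sub_eball yc => //.
  by rewrite mulrC ler_pdivrMr ?ltr0n// mul1r ler_nat.
- by move=> p pn; rewrite KE; exact: (cone_sqr_le delta0 delta_r r_lt a0 a1 ar n0 pn s0 sd).
Qed.
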